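(* Let $\mathcal{A}$ and $\mathcal{B}$ be arbitrary topological operads with $\mathcal{A}(0)=\{0\}$ and $\mathcal{B}(0)=\{0\}$. Then: (1) $(\mathcal{A}\otimes\mathcal{B})(1)\cong\mathcal{A}(1)\times\mathcal{B}(1)$. (2) $(\mathcal{A}\otimes\mathcal{B})(2)$ is homeomorphic to the pushout of the diagram $$\mathcal{A}(2)\times\mathcal{B}(1)^2\xleftarrow{\ g\ }\mathcal{A}(2)\times\mathcal{B}(2)\xrightarrow{\ f\ }\mathcal{A}(1)^2\times\mathcal{B}(2),$$ where $f(\alpha,\beta)=(\alpha\circ(id\oplus 0),\alpha\circ(0\oplus id),\beta)$ and $g(\alpha,\beta)=(\alpha,\beta\circ(id\oplus 0),\beta\circ(0\oplus id))$.
   Context: $\mathcal{T}op$ is the category of $k$-spaces. A topological operad is a symmetric operad $\{\mathcal{B}(n)\}_{n\ge 0}$ in $\mathcal{T}op$ with right $\Sigma_n$-actions, unit $id\in\mathcal{B}(1)$ and composition written $\beta\circ(\beta_1\oplus\dots\oplus\beta_k)$. Tensor product: $\mathcal{A}\otimes\mathcal{B}$ is the quotient operad of the coproduct of operads $\mathcal{A}\amalg\mathcal{B}$ by the interchange relations: for all $k,l\ge 0$, $\alpha\in\mathcal{A}(k)$, $\beta\in\mathcal{B}(l)$, $\alpha\circ(\beta\oplus\dots\oplus\beta)\circ\tau_{k,l}=\beta\circ(\alpha\oplus\dots\oplus\alpha)$ in arity $kl$, where $\tau_{k,l}\in\Sigma_{kl}$ is the permutation inducing the transposition $(X^k)^l\cong(X^l)^k$.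 *)

(* Defs.v *)
From HB Require Import structures.
From mathcomp Require Import all_boot all_fingroup.
From mathcomp Require Import all_classical topology.
From mathcomp Require order.
From Stdlib Require Relations.

Set Implicit Arguments.
Unset Strict Implicit.
Unset Printing Implicit Defensive.

Import order.tagnat.

Local Open Scope quotient_scope.
Local Open Scope classical_set_scope.

(* k-open sets are tested on all maps from compact Hausdorff spaces; no
   separation axiom is imposed on X. *)
Definition kopen (X : topologicalType) (U : set X) : Prop :=
  forall (D : topologicalType) (t : D -> X),
    compact [set: D] -> hausdorff_space D -> continuous t -> open (t @^-1` U).

Definition kspace (X : topologicalType) : Prop :=
  forall U : set X, kopen U -> open U.

Definition kify (X : topologicalType) : Type := X.

Section Kify.
Context {X : topologicalType}.

HB.instance Definition _ := Choice.copy (kify X) X.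

Definition kify_open : set (set (kify X)) := @kopen X.

Lemma kify_openT : kify_open setT.
Proof. by move=> D t _ _ _; rewrite preimage_setT; exact: openT. Qed.

Lemma kify_openI : setI_closed kify_open.
Proof.
move=> U V oU oV D t cD hD ct; rewrite preimage_setI.
by apply: openI; [exact: oU|exact: oV].
Qed.

Lemma kify_open_bigU (I : Type) (f : I -> set (kify X)) :
  (forall i, kify_open (f i)) -> kify_open (\bigcup_i f i).
Proof.
move=> of_ D t cD hD ct; rewrite preimage_bigcup.
by apply: bigcup_open => i _; exact: of_.
Qed.

HB.instance Definition _ :=
  isOpenTopological.Build (kify X) kify_openT kify_openI kify_open_bigU.

Lemma kify_openE (U : set (kify X)) : open U = @kopen X U.
Proof. by []. Qed.

End Kify.

(* the product in the category of k-spaces *)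
Definition kprod (X Y : topologicalType) : topologicalType := kify (X * Y)%type.

Definition homeomorphic (X Y : topologicalType) : Prop :=
  exists (f : X -> Y) (g : Y -> X),
    [/\ continuous f, continuous g, cancel f g & cancel g f].

(* The pushout of Y <-f- X -g-> Z: the quotient of the disjoint union of Y and Z
   by the equivalence relation generated by f x ~ g x. Disjoint unions and
   quotients of k-spaces are k-spaces, so this is also the pushout of k-spaces. *)
Section Pushout.
Context {X Y Z : topologicalType} (f : X -> Y) (g : X -> Z).

Definition pushout_sum : topologicalType :=
  {b : bool & (if b then Y else Z) : topologicalType}.

Definition pushout_inl (y : Y) : pushout_sum :=
  existT (fun b : bool => (if b then Y else Z) : topologicalType) true y.
Definition pushout_inr (z : Z) : pushout_sum :=
  existT (fun b : bool => (if b then Y else Z) : topologicalType) false z.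

Inductive pushout_step : pushout_sum -> pushout_sum -> Prop :=
| PushoutStep x : pushout_step (pushout_inl (f x)) (pushout_inr (g x)).

Definition pushout_rel (u v : pushout_sum) : bool :=
  `[< Relation_Operators.clos_refl_sym_trans _ pushout_step u v >].

Lemma pushout_rel_refl : reflexive pushout_rel.
Proof. by move=> u; apply/asboolP; exact: Relation_Operators.rst_refl. Qed.

Lemma pushout_rel_sym : symmetric pushout_rel.
Proof.
move=> u v; apply/asboolP/asboolP; exact: Relation_Operators.rst_sym.
Qed.

Lemma pushout_rel_trans : transitive pushout_rel.
Proof.
move=> v u w /asboolP uv /asboolP vw; apply/asboolP.
exact: Relation_Operators.rst_trans uv vw.
Qed.

Definition pushout_equiv :=
  EquivRel pushout_rel pushout_rel_refl pushout_rel_sym pushout_rel_trans.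

Definition pushout : topologicalType :=
  quotient_topology {eq_quot pushout_equiv}.

End Pushout.

(* In comments, o is operadic composition and + is the sum of operations. The
   inputs of b o (c_0 + ... + c_(k-1)), with c_i of arity n i, are the pairs (i, p)
   with i < k and p < n i, listed lexicographically: [Rank i p] is the position of
   (i, p) in 'I_(\sum_i n i). *)
Section OrdPerm.
Context (m n : nat) (e : m = n) (f : 'I_m -> 'I_n) (fI : injective f).

Lemma ord_perm_inj : injective (f \o cast_ord (esym e)).
Proof. by move=> u v /fI /cast_ord_inj. Qed.

Definition ord_perm : 'S_n := perm ord_perm_inj.

End OrdPerm.

Section BlockPerms.
Context (k : nat) (n : 'I_k -> nat).

Definition block_fun (s : 'S_k) (u : 'I_(\sum_i n (s i))) : 'I_(\sum_i n i) :=
  Rank (s (sig1 u)) (sig2 u).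

Lemma block_fun_inj (s : 'S_k) : injective (@block_fun s).
Proof.
move=> u v /(congr1 sig); rewrite /block_fun /Rank !rankK => e.
apply: sig_inj; rewrite !sigE12; move: (sig1 u) (sig2 u) (sig1 v) (sig2 v) e.
move=> i p j q e; have ij : i = j by exact/perm_inj/(congr1 tag e).
by subst j; move/eqP: e; rewrite eq_Tagged => /eqP <-.
Qed.

Lemma block_card (s : 'S_k) : \sum_i n (s i) = \sum_i n i.
Proof. by rewrite [RHS](reindex_inj (@perm_inj _ s)). Qed.

(* sends input p of block i to input p of block s i *)
Definition block_perm (s : 'S_k) : 'S_(\sum_i n i) :=
  ord_perm (block_card s) (@block_fun_inj s).

Definition dsum_fun (t : forall i, 'S_(n i)) (u : 'I_(\sum_i n i)) :
  'I_(\sum_i n i) := Rank (sig1 u) (t (sig1 u) (sig2 u)).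

Lemma dsum_fun_inj (t : forall i, 'S_(n i)) : injective (dsum_fun t).
Proof.
move=> u v /(congr1 sig); rewrite /dsum_fun /Rank !rankK => e.
apply: sig_inj; rewrite !sigE12; move: (sig1 u) (sig2 u) (sig1 v) (sig2 v) e.
move=> i p j q e; have ij : i = j by exact: (congr1 tag e).
by subst j; move/eqP: e; rewrite eq_Tagged => /eqP /perm_inj ->.
Qed.

(* t_0 + ... + t_(k-1) *)
Definition dsum_perm (t : forall i, 'S_(n i)) : 'S_(\sum_i n i) :=
  perm (@dsum_fun_inj t).

End BlockPerms.

Section Transpose.
Context (k l : nat).

Definition transpose_fun (u : 'I_(\sum_(i < k) l)) : 'I_(\sum_(j < l) k) :=
  Rank (sig2 u) (sig1 u).

Lemma transpose_fun_inj : injective transpose_fun.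
Proof.
move=> u v /(congr1 val)/eqP; rewrite eq_Rank => /andP[/eqP e2 /eqP/val_inj e1].
by apply: sig_inj; rewrite !sigE12 e1 e2.
Qed.

Lemma transpose_card : \sum_(i < k) l = \sum_(j < l) k.
Proof. by rewrite !sum_nat_const !card_ord mulnC. Qed.

(* sends input j of block i to input i of block j *)
Definition transpose_perm : 'S_(\sum_(j < l) k) :=
  ord_perm transpose_card transpose_fun_inj.

End Transpose.

Definition cast_arity (B : nat -> topologicalType) m n (e : m = n) (x : B m) : B n :=
  ecast i (B i) e x.

Arguments cast_arity B {m n} e x.

(* Products of permutations are read from left to right, so that
   [b . (s * t) = (b . s) . t] is a right action, and input i of b becomes input
   s i of b . s; in the endomorphism operad, (b . s) x = b (x \o s). Laws relating
   elements of arities that are only provably equal are stated in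
   {n : nat & B n}. *)
Record operad := Operad {
  op_space :> nat -> topologicalType;
  op_kspace : forall n, kspace (op_space n);
  op_id : op_space 1;
  op_act : forall n, op_space n -> 'S_n -> op_space n;
  op_comp : forall k (n : 'I_k -> nat),
    op_space k -> (forall i, op_space (n i)) -> op_space (\sum_i n i);
  op_act_continuous : forall n (s : 'S_n), continuous (fun x => op_act x s);
  op_comp_continuous : forall k (n : 'I_k -> nat),
    continuous
      (fun p : kprod (op_space k) (prod_topology (fun i => op_space (n i))) =>
         op_comp p.1 p.2);
  op_act1 : forall n (x : op_space n), op_act x 1%g = x;
  op_actM : forall n (x : op_space n) (s t : 'S_n),
    op_act x (s * t)%g = op_act (op_act x s) t;
  op_comp1l : forall n (x : op_space n),
    Tagged op_space (op_comp (n := fun _ : 'I_1 => n) op_id (fun _ => x))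
    = Tagged op_space x;
  op_comp1r : forall k (x : op_space k),
    Tagged op_space (op_comp (n := fun _ : 'I_k => 1) x (fun _ => op_id))
    = Tagged op_space x;
  op_compA : forall k (n : 'I_k -> nat) (m : 'I_(\sum_i n i) -> nat)
      (b : op_space k) (c : forall i, op_space (n i))
      (d : forall u, op_space (m u)),
    Tagged op_space (op_comp (op_comp b c) d)
    = Tagged op_space
        (op_comp (n := fun i => \sum_p m (Rank i p)) b
           (fun i => op_comp (n := fun p => m (Rank i p)) (c i)
              (fun p => d (Rank i p))));
  op_comp_actl : forall k (n : 'I_k -> nat) (b : op_space k) (s : 'S_k)
      (c : forall i, op_space (n i)),
    op_comp (op_act b s) c
    = op_act
        (cast_arity op_space (block_card n s)
           (op_comp (n := fun i => n (s i)) b (fun i => c (s i))))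
        (block_perm n s);
  op_comp_actr : forall k (n : 'I_k -> nat) (b : op_space k)
      (c : forall i, op_space (n i)) (t : forall i, 'S_(n i)),
    op_comp b (fun i => op_act (c i) (t i)) = op_act (op_comp b c) (dsum_perm t)
}.

Arguments op_id {o}.
Arguments op_act {o n}.
Arguments op_comp {o k} n.

Record operad_map (A B : operad) := OperadMap {
  op_map :> forall n, A n -> B n;
  op_map_continuous : forall n, continuous (@op_map n);
  op_map_id : op_map op_id = op_id;
  op_map_act : forall n (x : A n) (s : 'S_n),
    op_map (op_act x s) = op_act (op_map x) s;
  op_map_comp : forall k (n : 'I_k -> nat) (b : A k) (c : forall i, A (n i)),
    op_map (op_comp n b c) = op_comp n (op_map b) (fun i => op_map (c i))
}.

Arguments op_map {A B} _ n.

(* Coproducts of operads and quotients of operads by relations are determined up to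
   unique isomorphism by their universal properties among topological operads. *)
Definition is_coproduct (A B C : operad)
    (iA : operad_map A C) (iB : operad_map B C) : Prop :=
  forall (X : operad) (f : operad_map A X) (g : operad_map B X),
  exists h : operad_map C X,
    [/\ forall n (x : A n), h n (iA n x) = f n x,
        forall n (y : B n), h n (iB n y) = g n y
      & forall h' : operad_map C X,
          (forall n (x : A n), h' n (iA n x) = f n x) ->
          (forall n (y : B n), h' n (iB n y) = g n y) ->
          forall n (z : C n), h' n z = h n z].

Definition respects (C Q : operad) (R : forall n, C n -> C n -> Prop)
    (q : operad_map C Q) : Prop :=
  forall n (x y : C n), R n x y -> q n x = q n y.

Definition is_quotient (C Q : operad) (R : forall n, C n -> C n -> Prop)
    (q : operad_map C Q) : Prop :=
  respects R q /\
  forall (X : operad) (f : operad_map C X), respects R f ->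
  exists h : operad_map Q X,
    (forall n (x : C n), h n (q n x) = f n x) /\
    forall h' : operad_map Q X,
      (forall n (x : C n), h' n (q n x) = f n x) ->
      forall n (z : Q n), h' n z = h n z.

(* a o (b + ... + b) o tau_(k,l) ~ b o (a + ... + a) *)
Inductive interchange (A B C : operad)
    (iA : operad_map A C) (iB : operad_map B C) :
    forall n, C n -> C n -> Prop :=
| Interchange k l (a : A k) (b : B l) :
    interchange iA iB
      (op_act
         (cast_arity C (transpose_card k l)
            (op_comp (fun _ : 'I_k => l) (iA k a) (fun _ => iB l b)))
         (transpose_perm k l))
      (op_comp (fun _ : 'I_l => k) (iB l b) (fun _ => iA k a)).

Definition is_tensor (A B T : operad) : Prop :=
  exists (C : operad) (iA : operad_map A C) (iB : operad_map B C)
         (q : operad_map C T),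
    is_coproduct iA iB /\ is_quotient (interchange iA iB) q.

Section Restrict.
Context (B : operad) (z : B 0).

Lemma restrict_card (j : 'I_2) : \sum_(i < 2) (i == j : nat) = 1.
Proof. by rewrite -big_mkcond sum1_card card1. Qed.

(* restrict ord0 b = b o (id + 0) and restrict ord_max b = b o (0 + id) *)
Definition restrict (j : 'I_2) (b : B 2) : B 1 :=
  cast_arity B (restrict_card j)
    (op_comp (fun i => (i == j : nat)) b
       (fun i => if i == j as t return B (t : nat) then op_id else z)).

End Restrict.

Section RestrictPair.
Context (A B : operad) (zA : A 0) (zB : B 0).

Definition restrict_fst (p : kprod (A 2) (B 2)) :
    kprod (kprod (A 1) (A 1)) (B 2) :=
  ((restrict zA ord0 p.1, restrict zA ord_max p.1), p.2).

Definition restrict_snd (p : kprod (A 2) (B 2)) :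
    kprod (A 2) (kprod (B 1) (B 1)) :=
  (p.1, (restrict zB ord0 p.2, restrict zB ord_max p.2)).

End RestrictPair.

(* Main.v *)
From HB Require Import structures.
From mathcomp Require Import all_boot all_fingroup.
From mathcomp Require Import all_classical topology.
From mathcomp Require order.
Require Import Defs.

(* The tensor product T receives maps from A and B satisfying interchange, and is
   universal with this property. Multiplying in T defines maps
   phi1 : A(1) x B(1) -> T(1) and phi2 : P -> T(2), where P is the pushout; phi2 is
   well defined because interchange for a in A(2), b in B(2), restricted to the two
   diagonal inputs of the four, identifies the two legs. Both are onto: the
   operations of T whose restrictions to one and to two inputs (by plugging in 0
   elsewhere) lie in the images form a suboperad containing A and B.

   For the inverses one needs enough maps out of T. The space P carries a left action
   of the monoid M = A(1) x B(1) and a right action of M x M, and from any such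
   bimodule one builds a coskeletal operad X whose operations of arity n are families
   of one element of M for each input and one element of P for each ordered pair of
   distinct inputs. Restricting operations to at most two inputs maps A and B to X
   compatibly with interchange, hence T to X, and the coordinates of T -> X in arities
   one and two are inverse to phi1 and phi2. Continuity of the actions on P uses that
   products preserve quotient maps in the category of k-spaces.

   Identities between operations are checked by letting operations act on free
   algebras, where units, associativity and equivariance become plain substitution. *)

Set Implicit Arguments.
Unset Strict Implicit.
Unset Printing Implicit Defensive.

Import order.tagnat.

Local Open Scope classical_set_scope.

(** * k-spaces *)

(** A cluster point of the neighborhoods of a pair gives one in each factor, since cylinders over
    neighborhoods are neighborhoods. This makes products of test spaces available as test spaces. *)
Lemma hausdorff_prod (X Y : topologicalType) :
  hausdorff_space X -> hausdorff_space Y -> hausdorff_space (X * Y)%type.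
Proof.
move=> hX hY [x y] [x' y'] c; congr pair; [apply: hX|apply: hY] => U V nU nV.
  have [[a b] /= [[/= Ua _] [/= Va _]]] := c (U `*` setT) (V `*` setT)
    (ex_intro2 _ _ (U, setT) (conj nU filterT) (@subset_refl _ _))
    (ex_intro2 _ _ (V, setT) (conj nV filterT) (@subset_refl _ _)).
  by exists a.
have [[a b] /= [[/= _ Ub] [/= _ Vb]]] := c (setT `*` U) (setT `*` V)
  (ex_intro2 _ _ (setT, U) (conj filterT nU) (@subset_refl _ _))
  (ex_intro2 _ _ (setT, V) (conj filterT nV) (@subset_refl _ _)).
by exists b.
Qed.

Lemma kspace_compact_hausdorff (X : topologicalType) :
  compact [set: X] -> hausdorff_space X -> kspace X.
Proof. by move=> cX hX U /(_ X id cX hX); apply => x. Qed.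

Lemma kify_continuous (X : topologicalType) : continuous (id : kify X -> X).
Proof.
apply/continuousP => U oU; rewrite kify_openE => D t _ _ /continuousP; exact.
Qed.

(** The universal property of k-ification: a test map into [Z] followed by [f] is a test map into
    [X]. *)
Lemma kspace_continuous_kify (X Z : topologicalType) (f : Z -> X) :
  kspace Z -> continuous f -> continuous (f : Z -> kify X).
Proof.
move=> kZ cf; apply/continuousP => U; rewrite kify_openE => oU.
apply: kZ => D t cD hD ct.
by apply: (oU D (f \o t)) => // x; apply: continuous_comp; [exact: ct|exact: cf].
Qed.

(** Compact Hausdorff spaces are k-spaces, so [X] and [kify X] have the same test maps. *)
Lemma kspace_kify (X : topologicalType) : kspace (kify X).
Proof.
move=> U kU; rewrite kify_openE => D t cD hD ct; apply: kU => //.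
by apply: kspace_continuous_kify => //; exact: kspace_compact_hausdorff.
Qed.

Lemma continuous_compose (X Y Z : topologicalType) (f : X -> Y) (g : Y -> Z) :
  continuous f -> continuous g -> continuous (g \o f).
Proof. by move=> cf cg x; apply: continuous_comp; [exact: cf|exact: cg]. Qed.

Lemma kprod_fst_continuous (X Y : topologicalType) :
  continuous (fun p : kprod X Y => p.1 : X).
Proof.
apply: (continuous_compose (@kify_continuous (X * Y)%type) (g := fst)) => p.
exact: cvg_fst.
Qed.

Lemma kprod_snd_continuous (X Y : topologicalType) :
  continuous (fun p : kprod X Y => p.2 : Y).
Proof.
apply: (continuous_compose (@kify_continuous (X * Y)%type) (g := snd)) => p.
exact: cvg_snd.
Qed.

Lemma kprod_pair_continuous (X Y Z : topologicalType) (f : Z -> X) (g : Z -> Y) :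
  kspace Z -> continuous f -> continuous g ->
  continuous (fun z => (f z, g z) : kprod X Y).
Proof.
move=> kZ cf cg; apply: kspace_continuous_kify => // z.
by apply: cvg_pair; [exact: cf|exact: cg].
Qed.

Lemma prod_topology_continuous (Z : topologicalType) (I : eqType)
    (X : I -> topologicalType) (f : Z -> prod_topology X) :
  (forall i, continuous (fun z => f z i)) -> continuous f.
Proof.
move=> cf z; apply/cvg_sup => i.
move=> V [_ [[U oU <-] Uz] sUV]; apply: filterS sUV _.
by apply: cf; exact: open_nbhs_nbhs.
Qed.

Lemma kprod_proj_continuous (X : topologicalType) (I : eqType)
    (Y : I -> topologicalType) i :
  continuous (fun p : kprod X (prod_topology Y) => p.2 i).
Proof.
exact: (continuous_compose (@kprod_snd_continuous X (prod_topology Y))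
  (@proj_continuous I Y i)).
Qed.

(* Products with a fixed space preserve quotient maps in the category of k-spaces.
   For t : D -> P * Z and a point d of the preimage of W, a closed neighborhood K
   of d has {t1 d} x K in the preimage; the p with {p} x K in it form an open set by
   the tube lemma. *)
Lemma kprod_final (I : Type) (Y : I -> topologicalType) (P Z W : topologicalType)
    (q : forall i, Y i -> P) (F : P -> Z -> W) :
  (forall i, kspace (Y i)) ->
  (forall p, exists i y, q i y = p) ->
  (forall V : set P, (forall i, open (q i @^-1` V)) -> open V) ->
  (forall i, continuous (fun u : kprod (Y i) Z => F (q i u.1) u.2)) ->
  continuous (fun u : kprod P Z => F u.1 u.2).
Proof.
move=> kY qs qo cF; apply/continuousP => U oU; rewrite kify_openE => D t cD hD ct.
pose t1 d : P := (t d).1; pose t2 d : Z := (t d).2.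
have ct1 : continuous t1.
  by move=> d; apply: (@continuous_comp _ _ _ t fst); [exact: ct|exact: cvg_fst].
have ct2 : continuous t2.
  by move=> d; apply: (@continuous_comp _ _ _ t snd); [exact: ct|exact: cvg_snd].
have oF (E : topologicalType) i (s : E -> Y i) (v : E -> Z) :
    compact [set: E] -> hausdorff_space E -> continuous s -> continuous v ->
    open [set e | U (F (q i (s e)) (v e))].
  move=> cE hE cs cv; move/continuousP: (cF i) => /(_ U oU); rewrite kify_openE => o.
  apply: (o E (fun e => (s e, v e)) cE hE) => e.
  by apply: cvg_pair; [exact: cs|exact: cv].
rewrite openE => d /= Ud.
have [i [y qy]] := qs (t1 d).
have od : open [set d' | U (F (q i y) (t2 d'))].
  by apply: (oF D i (fun=> y)) => // x; exact: cvg_cst.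
have [K nK sK] : exists2 K, nbhs d K & closure K `<=` [set d' | U (F (q i y) (t2 d'))].
  have [|K nK sK] := @compact_regular _ d setT hD cD filterT
    [set d' | U (F (q i y) (t2 d'))]; last by exists K.
  by apply: open_nbhs_nbhs; split => //=; rewrite qy.
have cK : compact (closure K).
  by apply: subclosed_compact cD _ => //; exact: closed_closure.
pose V := [set p | forall d', closure K d' -> U (F p (t2 d'))].
have oV : open V.
  (* By finality openness is checked on each [Y j], and there, [Y j] being a k-space, along maps [s]
     from compact Hausdorff [E]. Then [E * D] is again a test space. *)
  apply: qo => j; apply: kY => E s cE hE cs.
  have oG : open [set w : E * D | U (F (q j (s w.1)) (t2 w.2))].
    apply: (oF (E * D)%type j (s \o fst) (t2 \o snd)).
    - by rewrite -setXTT; exact: compact_setX.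
    - exact: hausdorff_prod.
    - by move=> w; apply: continuous_comp; [exact: cvg_fst|exact: cs].
    - by move=> w; apply: continuous_comp; [exact: cvg_snd|exact: ct2].
  rewrite openE => e /= Ve.
  move/compact_near_coveringP: cK => /(_ E (nbhs e)
    (fun e d' => U (F (q j (s e)) (t2 d'))) _) /=; apply => d' Kd'.
  move: oG; rewrite openE => /(_ (e, d') (Ve _ Kd')) [[B1 B2] [/= n1 n2] sB].
  by exists (B2, B1) => // -[a b] /= [B2a B1b]; apply: (sB (b, a)).
have : nbhs d (t1 @^-1` V `&` K).
  apply: filterI => //; apply: ct1; apply: open_nbhs_nbhs; split => //.
  by rewrite -qy => d' /sK.
apply: filterS => d' [/= Vd' Kd']; apply: Vd'; exact: subset_closure.
Qed.

(** * Positions in iterated sums *)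

Lemma RankP k (n : 'I_k -> nat) (u : 'I_(\sum_i n i)) :
  exists i (p : 'I_(n i)), u = Rank i p.
Proof. by exists (sig1 u), (sig2 u); rewrite sig2K. Qed.

Lemma sig_Rank k (n : 'I_k -> nat) (T : Type) (g : forall i, 'I_(n i) -> T) i
    (p : 'I_(n i)) :
  g (sig1 (Rank i p)) (sig2 (Rank i p)) = g i p.
Proof. by rewrite /sig1 /sig2 /Rank rankK. Qed.

Lemma Rank_const1l n (i : 'I_1) (p : 'I_n) :
  Rank (p_ := fun _ : 'I_1 => n) i p = p :> nat.
Proof. by rewrite RankEsum big_pred0 // => j; rewrite !ord1. Qed.

Lemma Rank_const1r k (i : 'I_k) (p : 'I_1) :
  Rank (p_ := fun _ : 'I_k => 1) i p = i :> nat.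
Proof.
rewrite RankEsum ord1 addn0.
by rewrite -(big_ord_widen k (fun=> 1) (ltnW (ltn_ord i))) sum1_card card_ord.
Qed.

Lemma big_Rank k (n : 'I_k -> nat) (Q : pred 'I_(\sum_i n i))
    (F : 'I_(\sum_i n i) -> nat) :
  \sum_(u | Q u) F u = \sum_i \sum_(p | Q (Rank i p)) F (Rank i p).
Proof.
rewrite (reindex (@rank k n)) /=; last exact: onW_bij rank_bij.
rewrite (sig_big_dep xpredT (fun i p => Q (Rank i p))
  (fun i p => F (Rank i p))) /=.
by apply: eq_big => [[i p]|[i p] _].
Qed.

Lemma ltn_Rank k (n : 'I_k -> nat) i (p : 'I_(n i)) j (q : 'I_(n j)) :
  (Rank i p < Rank j q)%N = (i < j)%N || ((i == j) && (p < q)%N).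
Proof.
have := lt_rank (Tagged (fun i => 'I_(n i)) p) (Tagged (fun i => 'I_(n i)) q).
rewrite /Rank preorder.Order.OrdinalOrder.ltEord => ->.
rewrite order.Order.SigmaOrder.ltEsig /= preorder.Order.OrdinalOrder.leEord.
case: (ltngtP i j) => //= [ij|/val_inj ij]; first by rewrite -(inj_eq val_inj) gtn_eqF.
by subst j; rewrite eqxx tagged_asE.
Qed.

(** Both sides count the inputs that precede [r]: those in outer blocks before [i], those in inner
    blocks of [i] before [p], and those before [r] in its own block. The sum over preceding pairs is
    split by whether the outer index is less than [i] or equal to it. *)
Lemma RankA k (n : 'I_k -> nat) (m : 'I_(\sum_i n i) -> nat) i (p : 'I_(n i))
    (r : 'I_(m (Rank i p))) :
  Rank (Rank i p) r =
  Rank (p_ := fun i => \sum_p m (Rank i p)) i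
    (Rank (p_ := fun p => m (Rank i p)) p r) :> nat.
Proof.
rewrite [LHS]RankEsum [RHS]RankEsum [X in _ = _ + X]RankEsum addnA.
congr (_ + _); rewrite big_Rank.
rewrite (bigID (fun j : 'I_k => (j < i)%N)) /=; congr (_ + _).
  apply: eq_bigr => j ji; apply: eq_bigl => q; by rewrite ltn_Rank ji.
rewrite (bigD1 i) ?ltnn //= [X in _ + X]big1 ?addn0.
  by apply: eq_bigl => q; rewrite ltn_Rank ltnn eqxx.
move=> j /andP[ij /negPf ji]; rewrite big_pred0 // => q.
by rewrite ltn_Rank ji (negPf ij).
Qed.

(** * Labelled operations *)

Lemma Tagged_cast (B : nat -> topologicalType) m n (x : B m) (y : B n) :
  Tagged B x = Tagged B y -> exists e : m = n, cast_arity B e x = y.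
Proof.
(* Both sides are made variables, so that their equality can be destructed. *)
have K (u v : {n & B n}) : u = v ->
    exists e : tag u = tag v, cast_arity B e (tagged u) = tagged v.
  by move=> <-; exists erefl.
exact: K.
Qed.

Lemma cast_Tagged (B : nat -> topologicalType) m n (e : m = n) (x : B m) :
  Tagged B (cast_arity B e x) = Tagged B x.
Proof. by case: n / e. Qed.

Lemma op_comp_continuous_fun (O : operad) (Z : topologicalType) k (n : 'I_k -> nat)
    (x : Z -> O k) (c : forall i, Z -> O (n i)) :
  kspace Z -> continuous x -> (forall i, continuous (c i)) ->
  continuous (fun z => op_comp n (x z) (fun i => c i z)).
Proof.
move=> kZ cx cc.
apply: (@continuous_compose _ _ _
  (fun z => (x z, fun i => c i z) : kprod (O k) (prod_topology (fun i => O (n i))))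
  (fun p => op_comp n p.1 p.2)); last exact: op_comp_continuous.
by apply: kprod_pair_continuous => //; exact: prod_topology_continuous.
Qed.

(** The arity is a field, so operations whose arities are only provably equal can be compared by
    plain equality, without casts. *)
Record labelled (O : operad) (L : Type) := Lab {
  arity : nat;
  oper : O arity;
  label : 'I_arity -> L
}.
Arguments Lab {O L arity}.
Arguments oper {O L}.
Arguments label {O L}.

Section Labelled.
Context (O : operad).
Implicit Types L : Type.

(** The two index types differ, so labels are compared at positions that are equal as numbers. *)
Lemma Lab_eq L m n (x : O m) (y : O n) (l : 'I_m -> L) (l' : 'I_n -> L) :
  Tagged (op_space O) x = Tagged (op_space O) y ->
  (forall (i : 'I_m) (j : 'I_n), i = j :> nat -> l i = l' j) ->
  Lab x l = Lab y l'.
Proof.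
move/Tagged_cast => [e <-] h; case: n / e y l' h => y l' h.
by congr Lab; apply/funext => i; exact: h.
Qed.

Lemma Lab_inj L n (x y : O n) (l l' : 'I_n -> L) :
  Lab x l = Lab y l' -> x = y /\ l = l'.
Proof.
move=> E.
have [e] : exists e : n = n, ecast i (O i * ('I_i -> L))%type e (x, l) = (y, l').
  have K (u v : labelled O L) : u = v -> exists e : arity u = arity v,
      ecast i (O i * ('I_i -> L))%type e (oper u, label u) = (oper v, label v).
    by move=> <-; exists erefl.
  exact: K E.
(* Equality on [nat] is decidable, so the cast along [e : n = n] is the identity. *)
by rewrite (eq_axiomK e) /= => -[].
Qed.

(* The quotient of labelled operations by lsim is the free O-algebra on L. *)
Definition lsim L (e e' : labelled O L) : Prop :=
  exists s : 'S_(arity e),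
    e' = Lab (op_act (oper e) s) (fun i => label e ((s^-1)%g i)).

Lemma lsim_refl L (e : labelled O L) : lsim e e.
Proof.
exists 1%g; case: e => n x l /=; rewrite op_act1; congr Lab.
by apply/funext => i; rewrite invg1 perm1.
Qed.

Lemma lsim_sym L (e e' : labelled O L) : lsim e e' -> lsim e' e.
Proof.
case: e => n x l [s ->] /=; exists (s^-1)%g => /=.
rewrite -op_actM mulgV op_act1; congr Lab.
by apply/funext => i; rewrite invgK permK.
Qed.

Lemma lsim_trans L (e2 e1 e3 : labelled O L) :
  lsim e1 e2 -> lsim e2 e3 -> lsim e1 e3.
Proof.
case: e1 => n x l [s ->] [t ->] /=; exists (s * t)%g => /=.
by rewrite -op_actM; congr Lab; apply/funext => i; rewrite invMg permM.
Qed.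

Lemma lsim_act L n (x : O n) (s : 'S_n) (l : 'I_n -> L) :
  lsim (Lab (op_act x s) l) (Lab x (fun i => l (s i))).
Proof.
apply: lsim_sym; exists s; congr Lab.
by apply/funext => i /=; rewrite permKV.
Qed.

(** The structure map of the free algebra, on representatives. *)
Definition eval L k (x : O k) (e : 'I_k -> labelled O L) : labelled O L :=
  Lab (op_comp (fun i => arity (e i)) x (fun i => oper (e i)))
      (fun u => label (e (sig1 u)) (sig2 u)).

(** Choose a permutation for each argument. Equivariance in the inner operations collects them into
    one block-diagonal permutation, which the permuted labels undo. *)
Lemma eval_cong L k (x : O k) (e e' : 'I_k -> labelled O L) :
  (forall i, lsim (e i) (e' i)) -> lsim (eval x e) (eval x e').
Proof.
move=> h; pose s i := projT1 (cid (h i)).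
have -> : e' = fun i => Lab (op_act (oper (e i)) (s i))
    (fun j => label (e i) ((s i)^-1%g j)).
  by apply/funext => i; rewrite /s; case: cid.
rewrite /eval /= op_comp_actr; apply: lsim_sym.
apply: lsim_trans (lsim_act _ _ _) _; rewrite /dsum_perm.
have -> : (fun u : 'I_(\sum_i arity (e i)) =>
    label (e (sig1 (dsum_perm s u)))
      ((s (sig1 (dsum_perm s u)))^-1%g (sig2 (dsum_perm s u))))
  = (fun u => label (e (sig1 u)) (sig2 u)); last exact: lsim_refl.
apply/funext => u; rewrite /dsum_perm permE /dsum_fun.
by rewrite (sig_Rank (fun i p => label (e i) ((s i)^-1%g p))) permK.
Qed.

Lemma eval_act L k (x : O k) (s : 'S_k) (e : 'I_k -> labelled O L) :
  lsim (eval (op_act x s) e) (eval x (fun i => e (s i))).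
Proof.
rewrite /eval op_comp_actl; apply: lsim_trans (lsim_act _ _ _) _.
set lhs := Lab _ _; set rhs := Lab _ _; suff -> : lhs = rhs by exact: lsim_refl.
apply: Lab_eq; first by rewrite cast_Tagged.
move=> i j ij; rewrite /block_perm /ord_perm permE /= /block_fun.
rewrite (sig_Rank (fun i p => label (e i) p)).
by rewrite (_ : cast_ord _ i = j) //; apply: val_inj.
Qed.

(** Associativity gives an honest equality, not just [lsim], because lexicographic positions of
    nested blocks agree by [RankA]. *)
Lemma eval_comp L k (n : 'I_k -> nat) (x : O k) (c : forall i, O (n i))
    (e : 'I_(\sum_i n i) -> labelled O L) :
  eval (op_comp n x c) e = eval x (fun i => eval (c i) (fun p => e (Rank i p))).
Proof.
apply: Lab_eq; first exact: op_compA.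
move=> u v; have [w [r ->]] := RankP u; have [i [p E]] := RankP w.
rewrite (sig_Rank (fun w r => label (e w) r)).
subst w; rewrite RankA => /val_inj <-.
symmetry; apply: etrans.
  exact: (sig_Rank (fun i => label (eval (c i) (fun p => e (Rank i p))))).
exact: (sig_Rank (fun p r => label (e (Rank i p)) r)).
Qed.

Definition lit L (a : L) : labelled O L := Lab op_id (fun=> a).

Lemma eval_id L (e : 'I_1 -> labelled O L) : eval op_id e = e ord0.
Proof.
have -> : e = fun=> e ord0 by apply/funext => i; rewrite (ord1 i).
case: (e ord0) => n x l; apply: Lab_eq; first exact: op_comp1l.
move=> u v; have [i [p ->]] := RankP u; rewrite Rank_const1l => /val_inj <-.
exact: (sig_Rank (fun i p => l p)).
Qed.

Lemma eval_lit L k (x : O k) (l : 'I_k -> L) :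
  eval x (fun i => lit (l i)) = Lab x l.
Proof.
apply: Lab_eq; first exact: op_comp1r.
move=> u v; have [i [p ->]] := RankP u; rewrite Rank_const1r => /val_inj <-.
exact: (sig_Rank (fun i p => l i)).
Qed.

(** Substitution of elements of one free algebra for the letters of another. *)
Definition bind L L' (e : labelled O L) (f : L -> labelled O L') : labelled O L' :=
  eval (oper e) (fun i => f (label e i)).

Lemma bind_sim L L' (e e' : labelled O L) (f : L -> labelled O L') :
  lsim e e' -> lsim (bind e f) (bind e' f).
Proof.
case: e => n x l [s ->]; apply: lsim_sym.
apply: lsim_trans (eval_act _ _ _) _ => /=.
rewrite (_ : (fun i => _) = (fun i => f (l i))); first exact: lsim_refl.
by apply/funext => i; rewrite permK.
Qed.

Lemma bind_eval L L' k (x : O k) (e : 'I_k -> labelled O L)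
    (f : L -> labelled O L') :
  bind (eval x e) f = eval x (fun i => bind (e i) f).
Proof.
rewrite /bind eval_comp; congr eval; apply/funext => i; congr eval.
by apply/funext => p; rewrite (sig_Rank (fun i p => f (label (e i) p))).
Qed.

Definition gen n (x : O n) : labelled O 'I_n := Lab x id.

(** The inputs carry distinct labels, so only the identity permutation can relate the two sides.
    Equations between operations can therefore be checked in free algebras. *)
Lemma lsim_gen_inj n (x y : O n) : lsim (gen x) (gen y) -> x = y.
Proof.
move=> [s /Lab_inj [-> /= es]]; rewrite (_ : s = 1%g) ?op_act1 //.
by apply/permP => i; have := congr1 (@^~ (s i)) es; rewrite permK perm1.
Qed.

(* Unlike evaluation in the free algebra, plug lands in an honest arity m. *)
Section Plug.
Context (k m : nat) (n : 'I_k -> nat) (l : forall i, 'I_(n i) -> 'I_m).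
Context (c_card : \sum_i n i = m).
Context (l_inj : injective (fun u : 'I_(\sum_i n i) => @l (sig1 u) (sig2 u))).

Definition plug (x : O k) (c : forall i, O (n i)) : O m :=
  op_act (cast_arity O c_card (op_comp n x c)) (ord_perm c_card l_inj).

Lemma gen_plug (x : O k) (c : forall i, O (n i)) :
  lsim (gen (plug x c)) (eval x (fun i => Lab (c i) (@l i))).
Proof.
apply: lsim_trans (lsim_act _ _ _) _.
set lhs := Lab _ _; set rhs := eval _ _.
suff -> : lhs = rhs by exact: lsim_refl.
apply: Lab_eq; first by rewrite cast_Tagged.
move=> i j ij; rewrite /ord_perm permE /=.
by rewrite (_ : cast_ord _ i = j) //; apply: val_inj.
Qed.

Lemma plug_continuous (Z : topologicalType) (x : Z -> O k)
    (c : forall i, Z -> O (n i)) :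
  kspace Z -> continuous x -> (forall i, continuous (c i)) ->
  continuous (fun z => plug (x z) (fun i => c i z)).
Proof.
move=> kZ cx cc.
apply: (@continuous_compose _ _ _ (fun z => cast_arity O c_card
  (op_comp n (x z) (fun i => c i z))) (fun y => op_act y (ord_perm c_card l_inj)));
  last exact: op_act_continuous.
case: m / c_card => /=; exact: op_comp_continuous_fun.
Qed.

End Plug.

End Labelled.

(** * Actions of unary operations and restrictions *)

Section Multiplication.
Context {O : operad}.

Lemma eval_inj n (x y : O n) :
  (forall f : 'I_n -> labelled O 'I_n, lsim (eval x f) (eval y f)) -> x = y.
Proof.
by move=> h; apply: lsim_gen_inj; rewrite /gen -!(eval_lit _ id); exact: h.
Qed.

Lemma lmul_card n : \sum_(i < 1) n = n.
Proof. by rewrite big_ord1. Qed.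

Lemma lmul_inj n :
  injective (fun u : 'I_(\sum_(i < 1) n) => sig2 u).
Proof.
move=> u v; have [i [p ->]] := RankP u; have [j [q ->]] := RankP v.
rewrite !(sig_Rank (n := fun _ : 'I_1 => n) (fun _ p => p)) => ->.
by rewrite (ord1 i) (ord1 j).
Qed.

(** The left action of the monoid O(1) on O(n), landing in arity [n] itself instead of a sum over
    one block. *)
Definition lmul n (x : O 1) (y : O n) : O n :=
  plug (l := fun _ => id) (lmul_card n) (@lmul_inj n) x (fun=> y).

Lemma gen_lmul n (x : O 1) (y : O n) : lsim (gen (lmul x y)) (eval x (fun=> gen y)).
Proof. exact: gen_plug. Qed.

Lemma eval_lmul L n (x : O 1) (y : O n) (f : 'I_n -> labelled O L) :
  lsim (eval (lmul x y) f) (eval x (fun=> eval y f)).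
Proof. by have := bind_sim f (gen_lmul x y); rewrite bind_eval. Qed.

Lemma rmul_card k : \sum_(i < k) 1 = k.
Proof. by rewrite sum1_card card_ord. Qed.

Lemma rmul_inj k : injective (fun u : 'I_(\sum_(i < k) 1) => sig1 u).
Proof.
move=> u v; have [i [p ->]] := RankP u; have [j [q ->]] := RankP v.
by rewrite !Rank1K (ord1 p) (ord1 q) => ->.
Qed.

(** The right action of the k-fold power of O(1) on O(k), again without a cast in the result. *)
Definition rmul k (x : O k) (y : 'I_k -> O 1) : O k :=
  plug (l := fun i _ => i) (rmul_card k) (@rmul_inj k) x y.

Lemma gen_rmul k (x : O k) (y : 'I_k -> O 1) :
  lsim (gen (rmul x y)) (eval x (fun i => Lab (y i) (fun=> i))).
Proof. exact: gen_plug. Qed.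

Lemma eval_rmul L k (x : O k) (y : 'I_k -> O 1) (f : 'I_k -> labelled O L) :
  lsim (eval (rmul x y) f) (eval x (fun i => eval (y i) (fun=> f i))).
Proof. by have := bind_sim f (gen_rmul x y); rewrite bind_eval. Qed.

Lemma lmul1 n (x : O n) : lmul op_id x = x.
Proof.
apply: eval_inj => f; apply: lsim_trans (eval_lmul _ _ _) _.
by rewrite eval_id; exact: lsim_refl.
Qed.

Lemma rmul1 n (x : O n) : rmul x (fun=> op_id) = x.
Proof.
apply: eval_inj => f; apply: lsim_trans (eval_rmul _ _ _) _.
by under eq_fun do rewrite eval_id; exact: lsim_refl.
Qed.

Lemma lmulA n (x y : O 1) (u : O n) : lmul x (lmul y u) = lmul (lmul x y) u.
Proof.
apply: eval_inj => f; apply: lsim_trans (eval_lmul _ _ _) _.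
apply: lsim_trans (eval_cong _ (fun=> eval_lmul _ _ _)) _.
apply/lsim_sym/(lsim_trans (eval_lmul _ _ _)).
exact: lsim_trans (eval_lmul _ _ _) (lsim_refl _).
Qed.

Lemma rmul_lmul n (x : O 1) (u : O n) (y : 'I_n -> O 1) :
  lmul x (rmul u y) = rmul (lmul x u) y.
Proof.
apply: eval_inj => f; apply: lsim_trans (eval_lmul _ _ _) _.
apply: lsim_trans (eval_cong _ (fun=> eval_rmul _ _ _)) _.
apply/lsim_sym/(lsim_trans (eval_rmul _ _ _)).
exact: lsim_trans (eval_lmul _ _ _) (lsim_refl _).
Qed.

Lemma rmulA n (u : O n) (y y' : 'I_n -> O 1) :
  rmul (rmul u y) y' = rmul u (fun i => lmul (y i) (y' i)).
Proof.
apply: eval_inj => f; apply: lsim_trans (eval_rmul _ _ _) _.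
apply: lsim_trans (eval_rmul _ _ _) _.
apply/lsim_sym/(lsim_trans (eval_rmul _ _ _)).
apply: eval_cong => i; exact: lsim_trans (eval_lmul _ _ _) (lsim_refl _).
Qed.

Lemma rmul_unary (x : O 1) (y : 'I_1 -> O 1) : rmul x y = lmul x (y ord0).
Proof.
apply: eval_inj => f; apply: lsim_trans (eval_rmul _ _ _) _.
apply/lsim_sym/(lsim_trans (eval_lmul _ _ _)).
apply: eval_cong => i; rewrite (ord1 i).
by under [X in lsim _ (eval _ X)]eq_fun => j do rewrite -(ord1 j);
   exact: lsim_refl.
Qed.

Lemma lmul_continuous (Z : topologicalType) n (x : Z -> O 1) (y : Z -> O n) :
  kspace Z -> continuous x -> continuous y ->
  continuous (fun z => lmul (x z) (y z)).
Proof.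
move=> kZ cx cy.
exact: (@plug_continuous O 1 n (fun=> n) (fun=> id) _ _ Z x (fun=> y)).
Qed.

Lemma rmul_continuous (Z : topologicalType) k (x : Z -> O k) (y : Z -> 'I_k -> O 1) :
  kspace Z -> continuous x -> (forall i, continuous (fun z => y z i)) ->
  continuous (fun z => rmul (x z) (y z)).
Proof.
move=> kZ cx cy.
exact: (@plug_continuous O k k (fun=> 1) (fun i _ => i) _ _ Z x (fun i z => y z i)).
Qed.

End Multiplication.

(** * Restriction along injections of inputs *)

Section Restriction.
Context {O : operad} (z : O 0) (z_uniq : forall x : O 0, x = z).

Definition zero L : labelled O L :=
  Lab z (fun i : 'I_0 => match notF (valP i) with end).

Lemma Lab0 L n (x : O n) (l : 'I_n -> L) : n = 0 -> Lab x l = zero L.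
Proof.
move=> n0; subst n; apply: Lab_eq; first by rewrite (z_uniq x).
by case.
Qed.

(** The composite has arity zero, and there is only one operation of that arity. *)
Lemma eval0 L k (x : O k) (e : 'I_k -> labelled O L) :
  (forall i, e i = zero L) -> eval x e = zero L.
Proof.
move=> h; apply: Lab0; apply: big1 => i _; by rewrite h.
Qed.

Definition litz L (a : option L) : labelled O L := oapp (@lit O L) (zero L) a.

Lemma arity_litz L (a : option L) : arity (litz a) = isSome a.
Proof. by case: a. Qed.

Lemma label_litz L (a : option L) (p : 'I_(arity (litz a))) :
  a = Some (label (litz a) p).
Proof. by case: a p => [a p|[]]. Qed.

Section Restr.
Context (m n : nat) (w : 'I_m -> 'I_n) (w_inj : injective w).

Definition preim (i : 'I_n) : option 'I_m := [pick a | w a == i].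

Lemma preim_w a : preim (w a) = Some a.
Proof.
rewrite /preim; case: pickP => [b /eqP/w_inj -> //|/(_ a)]; by rewrite eqxx.
Qed.

Lemma preim_some i a : preim i = Some a -> i = w a.
Proof. by rewrite /preim; case: pickP => // b /eqP <- [->]. Qed.

Lemma restr_card : \sum_i arity (litz (preim i)) = m.
Proof.
under eq_bigr do rewrite arity_litz.
rewrite -big_mkcond /= sum1_card -[RHS](card_ord m) -(card_codom w_inj).
apply: eq_card => i; apply/idP/codomP; rewrite unfold_in /=.
  by case E : (preim i) => [a|//] _; exists a; exact: preim_some.
by move=> [a ->]; rewrite preim_w.
Qed.

(** A label determines its block, and every block has at most one input. *)
Lemma restr_inj : injective (fun u : 'I_(\sum_i arity (litz (preim i))) =>
  label (litz (preim (sig1 u))) (sig2 u)).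
Proof.
move=> u v; have [i [p ->]] := RankP u; have [j [q ->]] := RankP v.
rewrite (sig_Rank (fun i p => label (litz (preim i)) p)).
rewrite (sig_Rank (fun i p => label (litz (preim i)) p)) => E.
have ij : i = j.
  by rewrite (preim_some (label_litz p)) (preim_some (label_litz q)) E.
subst j; congr Rank; apply: val_inj => /=.
have l1 (r : 'I_(arity (litz (preim i)))) : r = 0 :> nat.
  by have := ltn_ord r; rewrite [X in (_ < X)%N]arity_litz;
     case: (isSome _) => //; rewrite ltnS leqn0 => /eqP.
by rewrite !l1.
Qed.

(** Inputs in the image of [w] stay open and are numbered through [w]; all others are filled with
    the nullary operation. *)
Definition restr (x : O n) : O m :=
  plug (l := fun i => label (litz (preim i))) restr_card restr_inj x
    (fun i => oper (litz (preim i))).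

Lemma gen_restr (x : O n) : lsim (gen (restr x)) (eval x (fun i => litz (preim i))).
Proof. exact: gen_plug. Qed.

Lemma eval_restr L (x : O n) (f : 'I_m -> labelled O L) (e : 'I_n -> labelled O L) :
  (forall a, e (w a) = f a) -> (forall i, (forall a, i != w a) -> e i = zero L) ->
  lsim (eval (restr x) f) (eval x e).
Proof.
move=> ew e0.
have := bind_sim f (gen_restr x).
rewrite bind_eval; congr lsim; congr eval; apply/funext => i.
case E : (preim i) => [a|] /=; first by rewrite /bind eval_id (preim_some E).
rewrite e0; first by apply: Lab0; rewrite big_ord0.
by move=> a; apply: contra_eq_neq E => ->; rewrite preim_w.
Qed.

Lemma restr_continuous : continuous restr.
Proof.
apply: (@plug_continuous O n m _ (fun i => label (litz (preim i))) _ _ (O n) id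
  (fun i _ => oper (litz (preim i)))) => [|x|i x].
- exact: op_kspace.
- exact: cvg_id.
- exact: cvg_cst.
Qed.

End Restr.

End Restriction.


Definition pair2 (T : Type) (a b : T) (i : 'I_2) : T := if i == ord0 then a else b.

Lemma ord2P (i : 'I_2) : i = ord0 \/ i = ord_max.
Proof. by case: i => -[|[|//]] h; [left|right]; apply: val_inj. Qed.

Lemma pair2_eta (T : Type) (f : 'I_2 -> T) : pair2 (f ord0) (f ord_max) = f.
Proof. by apply/funext => i; case: (ord2P i) => ->. Qed.

Lemma pair2_comp (T U : Type) (g : T -> U) a b i :
  g (pair2 a b i) = pair2 (g a) (g b) i.
Proof. by rewrite /pair2; case: ifP. Qed.

Lemma pair2_inj (T : eqType) (a b : T) : a != b -> injective (pair2 a b).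
Proof.
move=> ab u v; rewrite /pair2.
case: eqVneq => u0; case: eqVneq => v0 E; apply: val_inj.
- by rewrite u0 v0.
- by rewrite E eqxx in ab.
- by rewrite E eqxx in ab.
- by case: u v u0 v0 {E} => -[|[|]] // ? [[|[|]]].
Qed.

(** * Restrictions to one and to two inputs *)

Section Coordinates.
Context {O : operad} (z : O 0) (z_uniq : forall x : O 0, x = z).

Lemma const1_inj n (j : 'I_n) : injective (fun _ : 'I_1 => j).
Proof. by move=> a b _; rewrite (ord1 a) (ord1 b). Qed.

Definition restr1 n (x : O n) (j : 'I_n) : O 1 := restr z (@const1_inj n j) x.

Definition restr2 n (x : O n) (i j : 'I_n) (ij : i != j) : O 2 :=
  restr z (pair2_inj ij) x.

Local Notation zero := (zero z).

Lemma eval_restr1 L n (x : O n) j (f : 'I_1 -> labelled O L) :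
  lsim (eval (restr1 x j) f) (eval x (fun u => if u == j then f ord0 else zero L)).
Proof.
apply: (eval_restr z_uniq) => [a|i /(_ ord0)/negPf -> //].
by rewrite eqxx (ord1 a).
Qed.

Lemma eval_restr2 L n (x : O n) i j (ij : i != j) (f : 'I_2 -> labelled O L) :
  lsim (eval (restr2 x ij) f) (eval x (fun u =>
    if u == i then f ord0 else if u == j then f ord_max else zero L)).
Proof.
apply: (eval_restr z_uniq) => [a|k h]; last first.
  by rewrite (negPf (h ord0)) (negPf (h ord_max)).
case: (ord2P a) => ->; rewrite /pair2 /= ?eqxx //.
by rewrite eq_sym (negPf ij).
Qed.

Lemma restr1_act n (x : O n) (s : 'S_n) i : restr1 (op_act x s) (s i) = restr1 x i.
Proof.
apply: eval_inj => f; apply: lsim_trans (eval_restr1 _ _ _) _.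
apply: lsim_trans (eval_act _ _ _) _; apply: lsim_sym.
apply: lsim_trans (eval_restr1 _ _ _) _; apply: eval_cong => u.
by rewrite (inj_eq perm_inj); exact: lsim_refl.
Qed.

Lemma restr2_act n (x : O n) (s : 'S_n) i j (ij : i != j) (sij : s i != s j) :
  restr2 (op_act x s) sij = restr2 x ij.
Proof.
apply: eval_inj => f; apply: lsim_trans (eval_restr2 _ _ _) _.
apply: lsim_trans (eval_act _ _ _) _; apply: lsim_sym.
apply: lsim_trans (eval_restr2 _ _ _) _; apply: eval_cong => u.
by rewrite !(inj_eq perm_inj); exact: lsim_refl.
Qed.

Lemma Rank_eq k (n : 'I_k -> nat) i (p : 'I_(n i)) j (q : 'I_(n j)) :
  (Rank i p == Rank j q) = (i == j) && (p == q :> nat).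
Proof. by rewrite -val_eqE eq_Rank. Qed.

Lemma Rank_eq_same k (n : 'I_k -> nat) i (p q : 'I_(n i)) :
  (Rank i p == Rank i q) = (p == q).
Proof. by rewrite Rank_eq eqxx val_eqE. Qed.

Lemma Rank_eq_diff k (n : 'I_k -> nat) i (p : 'I_(n i)) j (q : 'I_(n j)) :
  i != j -> (Rank i p == Rank j q) = false.
Proof. by move=> ij; rewrite Rank_eq (negPf ij). Qed.

(** A block all of whose inputs receive zero is itself zero, so restricting a composite restricts
    the outer operation to the blocks that are met. This formula and the two for [restr2] are the
    model for composition in the coskeleton. *)
Lemma restr1_comp k (n : 'I_k -> nat) (x : O k) (c : forall i, O (n i)) i
    (p : 'I_(n i)) :
  restr1 (op_comp n x c) (Rank i p) = lmul (restr1 x i) (restr1 (c i) p).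
Proof.
apply: eval_inj => f; apply: lsim_trans (eval_restr1 _ _ _) _.
rewrite eval_comp; apply: lsim_sym.
apply: lsim_trans (eval_lmul _ _ _) _.
apply: lsim_trans (eval_restr1 _ _ _) _; apply: eval_cong => j.
case: eqVneq => [->|ji]; last first.
  rewrite (eval0 z_uniq) //; first exact: lsim_refl.
  by move=> q; rewrite Rank_eq_diff.
apply: lsim_trans (eval_restr1 _ _ _) _; apply: eval_cong => q.
by rewrite Rank_eq_same; exact: lsim_refl.
Qed.

Lemma restr2_comp_same k (n : 'I_k -> nat) (x : O k) (c : forall i, O (n i)) i
    (p q : 'I_(n i)) (pq : p != q) (h : Rank i p != Rank i q) :
  restr2 (op_comp n x c) h = lmul (restr1 x i) (restr2 (c i) pq).
Proof.
apply: eval_inj => f; apply: lsim_trans (eval_restr2 _ _ _) _.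
rewrite eval_comp; apply: lsim_sym.
apply: lsim_trans (eval_lmul _ _ _) _.
apply: lsim_trans (eval_restr1 _ _ _) _; apply: eval_cong => j.
case: eqVneq => [->|ji]; last first.
  rewrite (eval0 z_uniq) //; first exact: lsim_refl.
  by move=> r; rewrite !Rank_eq_diff.
apply: lsim_trans (eval_restr2 _ _ _) _; apply: eval_cong => r.
by rewrite !Rank_eq_same; exact: lsim_refl.
Qed.

Lemma restr2_comp_diff k (n : 'I_k -> nat) (x : O k) (c : forall i, O (n i)) i j
    (p : 'I_(n i)) (q : 'I_(n j)) (ij : i != j) (h : Rank i p != Rank j q) :
  restr2 (op_comp n x c) h
  = rmul (restr2 x ij) (pair2 (restr1 (c i) p) (restr1 (c j) q)).
Proof.
apply: eval_inj => f; apply: lsim_trans (eval_restr2 _ _ _) _.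
rewrite eval_comp; apply: lsim_sym.
apply: lsim_trans (eval_rmul _ _ _) _.
apply: lsim_trans (eval_restr2 _ _ _) _; apply: eval_cong => k'.
rewrite /pair2 /=.
case: eqVneq => [->|k'i]; last case: eqVneq => [->|k'j].
- apply: lsim_trans (eval_restr1 _ _ _) _; apply: eval_cong => r.
  by rewrite Rank_eq_same Rank_eq_diff //; exact: lsim_refl.
- apply: lsim_trans (eval_restr1 _ _ _) _; apply: eval_cong => r.
  by rewrite Rank_eq_same Rank_eq_diff 1?eq_sym //; exact: lsim_refl.
- rewrite (eval0 z_uniq) //; first exact: lsim_refl.
  by move=> r; rewrite !Rank_eq_diff.
Qed.

Lemma restr1_unary (x : O 1) i : restr1 x i = x.
Proof.
apply: eval_inj => f; apply: lsim_trans (eval_restr1 _ _ _) _.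
by apply: eval_cong => u; rewrite (ord1 u) (ord1 i); exact: lsim_refl.
Qed.

Lemma restr2_binary (x : O 2) (h : ord0 != ord_max) : restr2 x h = x.
Proof.
apply: eval_inj => f; apply: lsim_trans (eval_restr2 _ _ _) _.
by apply: eval_cong => u; case: (ord2P u) => ->; exact: lsim_refl.
Qed.

Lemma restr1_restr2l n (x : O n) i j (ij : i != j) :
  restr1 (restr2 x ij) ord0 = restr1 x i.
Proof.
apply: eval_inj => f; apply: lsim_trans (eval_restr1 _ _ _) _.
apply: lsim_trans (eval_restr2 _ _ _) _; apply: lsim_sym.
apply: lsim_trans (eval_restr1 _ _ _) _; apply: eval_cong => u /=.
by case: eqVneq => _; [|rewrite if_same]; exact: lsim_refl.
Qed.

Lemma restr1_restr2r n (x : O n) i j (ij : i != j) :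
  restr1 (restr2 x ij) ord_max = restr1 x j.
Proof.
apply: eval_inj => f; apply: lsim_trans (eval_restr1 _ _ _) _.
apply: lsim_trans (eval_restr2 _ _ _) _; apply: lsim_sym.
apply: lsim_trans (eval_restr1 _ _ _) _; apply: eval_cong => u /=.
case: (eqVneq u i) => [->|_]; last exact: lsim_refl.
by rewrite (negPf ij); exact: lsim_refl.
Qed.

Lemma restr1_lmul n (a : O 1) (x : O n) i : restr1 (lmul a x) i = lmul a (restr1 x i).
Proof.
apply: eval_inj => f; apply: lsim_trans (eval_restr1 _ _ _) _.
apply: lsim_trans (eval_lmul _ _ _) _; apply: lsim_sym.
apply: lsim_trans (eval_lmul _ _ _) _; apply: eval_cong => u.
exact: eval_restr1.
Qed.

Lemma restr1_rmul n (x : O n) (y : 'I_n -> O 1) i :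
  restr1 (rmul x y) i = lmul (restr1 x i) (y i).
Proof.
apply: eval_inj => f; apply: lsim_trans (eval_restr1 _ _ _) _.
apply: lsim_trans (eval_rmul _ _ _) _; apply: lsim_sym.
apply: lsim_trans (eval_lmul _ _ _) _.
apply: lsim_trans (eval_restr1 _ _ _) _; apply: eval_cong => u.
case: eqVneq => [->|_]; last by rewrite (eval0 z_uniq) //; exact: lsim_refl.
by apply: eval_cong => v; rewrite (ord1 v); exact: lsim_refl.
Qed.

(** Links the maps in the pushout diagram to the restrictions used in calculations: both feed [b] a
    literal at input [j] and zero at the other input. *)
Lemma restrictE (b : O 2) j : restrict z j b = restr1 b j.
Proof.
apply: lsim_gen_inj; apply: (@lsim_trans _ _ (eval b (fun i =>
    if i == j then lit O ord0 else zero 'I_1))); last first.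
  rewrite /gen -(eval_lit _ id); apply: lsim_sym.
  exact: eval_restr1.
suff -> : gen (restrict z j b) = eval b (fun i =>
    if i == j then lit O ord0 else zero 'I_1) by exact: lsim_refl.
transitivity (eval b (fun i : 'I_2 =>
    Lab (if i == j as t return O (t : nat) then op_id else z) (fun=> ord0 : 'I_1))).
  apply: Lab_eq; first exact: cast_Tagged.
  by move=> i' j' _; rewrite (ord1 i').
congr eval; apply/funext => i; case: (i == j) => //.
exact: Lab0.
Qed.

Lemma restr1_continuous n i : continuous (fun x : O n => restr1 x i).
Proof. exact: restr_continuous. Qed.

Lemma restr2_continuous n i j (ij : i != j) : continuous (fun x : O n => restr2 x ij).
Proof. exact: restr_continuous. Qed.

End Coordinates.

(** * Operad maps preserve the actions and the restrictions *)

Section Maps.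
Context (O O' : operad) (F : operad_map O O').

Definition map_labelled L (e : labelled O L) : labelled O' L :=
  Lab (F _ (oper e)) (label e).

Lemma map_eval L k (x : O k) (e : 'I_k -> labelled O L) :
  map_labelled (eval x e) = eval (F _ x) (fun i => map_labelled (e i)).
Proof. by rewrite /map_labelled /eval /= op_map_comp. Qed.

Lemma map_lsim L (e e' : labelled O L) :
  lsim e e' -> lsim (map_labelled e) (map_labelled e').
Proof.
by case: e => n x l [s ->]; exists s; rewrite /map_labelled /= op_map_act.
Qed.

Lemma map_lmul n (x : O 1) (y : O n) : F _ (lmul x y) = lmul (F _ x) (F _ y).
Proof.
apply: lsim_gen_inj; apply: (lsim_trans (map_lsim (gen_lmul x y))).
by rewrite map_eval; apply: lsim_sym; exact: gen_lmul.
Qed.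

Lemma map_rmul k (x : O k) (y : 'I_k -> O 1) :
  F _ (rmul x y) = rmul (F _ x) (fun i => F _ (y i)).
Proof.
apply: lsim_gen_inj; apply: (lsim_trans (map_lsim (gen_rmul x y))).
by rewrite map_eval; apply: lsim_sym; exact: gen_rmul.
Qed.

Context (z : O 0).
Context (z' : O' 0) (hz' : forall x : O' 0, x = z').

Lemma map_litz L (a : option L) : map_labelled (litz z a) = litz z' a.
Proof.
case: a => [a|]; first by rewrite /map_labelled /= op_map_id.
by rewrite /map_labelled /= (hz' (F _ z)).
Qed.

Lemma map_restr m n (w : 'I_m -> 'I_n) (wI : injective w) (x : O n) :
  F _ (restr z wI x) = restr z' wI (F _ x).
Proof.
apply: lsim_gen_inj; apply: (lsim_trans (map_lsim (gen_restr z wI x))).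
rewrite map_eval; apply: lsim_sym; apply: (lsim_trans (gen_restr z' wI (F _ x))).
by apply: eval_cong => i; rewrite -map_litz; exact: lsim_refl.
Qed.

End Maps.

(** * The coskeleton operad *)

(* The monoid bm and the bimodule bp stand for the operations of arity one and two of
   an operad. *)
Record bimodule := Bimodule {
  bm : topologicalType;
  bp : topologicalType;
  bone : bm;
  bmul : bm -> bm -> bm;
  bl : bm -> bp -> bp;
  br : bp -> bm -> bm -> bp;
  bmul_continuous : continuous (fun u : kprod bm bm => bmul u.1 u.2);
  bl_continuous : continuous (fun u : kprod bp bm => bl u.2 u.1);
  br_continuous : continuous (fun u : kprod bp (kprod bm bm) => br u.1 u.2.1 u.2.2);
  bmul1l : forall a, bmul bone a = a;
  bmul1r : forall a, bmul a bone = a;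
  bmulA : forall a b c, bmul a (bmul b c) = bmul (bmul a b) c;
  bl1 : forall x, bl bone x = x;
  blA : forall a b x, bl a (bl b x) = bl (bmul a b) x;
  br1 : forall x, br x bone bone = x;
  brA : forall x a b a' b', br (br x a b) a' b' = br x (bmul a a') (bmul b b');
  blr : forall a x b c, bl a (br x b c) = br (bl a x) b c
}.

Section Cosk.
Context (B : bimodule).

Definition offdiag n : Type := {d : 'I_n * 'I_n | d.1 != d.2}.
HB.instance Definition _ n := Choice.on (offdiag n).

(* The coskeleton: an operation of arity n is recorded by its restrictions to one
   and to two inputs. No compatibility between them is imposed. *)
Definition cosk n : topologicalType :=
  kify (prod_topology (fun _ : 'I_n => bm B) *
        prod_topology (fun _ : offdiag n => bp B))%type.

Definition cosk2 n (x : cosk n) i j (ij : i != j) : bp B :=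
  x.2 (exist (fun d : 'I_n * 'I_n => d.1 != d.2) (i, j) ij).

Lemma cosk2_eq n (x : cosk n) i j (ij : i != j) i' j' (ij' : i' != j') :
  i = i' -> j = j' -> cosk2 x ij = cosk2 x ij'.
Proof. by move=> ? ?; subst i' j'; rewrite (bool_irrelevance ij ij'). Qed.

Lemma cosk_ext n (x y : cosk n) :
  (forall i, x.1 i = y.1 i) -> (forall i j (ij : i != j), cosk2 x ij = cosk2 y ij) ->
  x = y.
Proof.
case: x y => [x1 x2] [y1 y2] /= h1 h2; congr pair; apply/funext => // -[[i j] ij].
exact: h2.
Qed.

Lemma cosk_Tagged m n (x : cosk m) (y : cosk n) :
  m = n -> (forall (i : 'I_m) (j : 'I_n), i = j :> nat -> x.1 i = y.1 j) ->
  (forall (i i' : 'I_m) (h : i != i') (j j' : 'I_n) (h' : j != j'),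
     i = j :> nat -> i' = j' :> nat -> cosk2 x h = cosk2 y h') ->
  Tagged cosk x = Tagged cosk y.
Proof.
move=> e; case: n / e y => y h1 h2; congr Tagged.
by apply: cosk_ext => *; [exact: h1|exact: h2].
Qed.

Lemma cosk_continuous (Z : topologicalType) n (f : Z -> cosk n) :
  kspace Z -> (forall i, continuous (fun z => (f z).1 i)) ->
  (forall i j (ij : i != j), continuous (fun z => cosk2 (f z) ij)) -> continuous f.
Proof.
move=> kZ h1 h2.
have -> : f = fun z => ((f z).1, (f z).2) by apply/funext => z; case: (f z).
apply: (@kprod_pair_continuous (prod_topology _) (prod_topology _)) => //.
  by apply: (@prod_topology_continuous _ _ _ (fun z => (f z).1)).
apply: (@prod_topology_continuous _ _ _ (fun z => (f z).2)) => -[[i j] ij].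
exact: h2.
Qed.

Lemma cosk1_continuous n i : continuous (fun x : cosk n => x.1 i).
Proof.
apply: (@continuous_compose _ (prod_topology _) _ (fun x : cosk n => x.1)
  (fun g : prod_topology (fun _ : 'I_n => bm B) => g i)).
  exact: kprod_fst_continuous.
exact: (@proj_continuous _ _ i).
Qed.

Lemma cosk2_continuous n i j (ij : i != j) : continuous (fun x : cosk n => cosk2 x ij).
Proof.
apply: (@continuous_compose _ (prod_topology _) _ (fun x : cosk n => x.2)
  (fun g : prod_topology (fun _ : offdiag n => bp B) => g (exist _ (i, j) ij))).
  exact: kprod_snd_continuous.
exact: (@proj_continuous (offdiag n) (fun=> bp B)).
Qed.

Lemma offdiag1 (d : offdiag 1) : False.
Proof. by case: d => -[i j] /=; rewrite (ord1 i) (ord1 j). Qed.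

Definition cosk_id : cosk 1 := (fun=> bone B, fun d => match offdiag1 d with end).

Definition offdiag_map m n (f : 'I_m -> 'I_n) (fI : injective f) (d : offdiag m) :
    offdiag n :=
  exist (fun d : 'I_n * 'I_n => d.1 != d.2) (f (val d).1, f (val d).2)
    (contra_neq (@fI _ _) (valP d)).

(** The inverse appears because input [i] of [x] has to become input [s i] of the result. *)
Definition cosk_act n (x : cosk n) (s : 'S_n) : cosk n :=
  (fun i => x.1 (s^-1%g i), fun d => x.2 (offdiag_map (@perm_inj _ s^-1%g) d)).

Lemma cosk1_act n (x : cosk n) (s : 'S_n) i : (cosk_act x s).1 (s i) = x.1 i.
Proof. by rewrite /= permK. Qed.

Lemma cosk2_act n (x : cosk n) (s : 'S_n) i j (ij : i != j) (h : s i != s j) :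
  cosk2 (cosk_act x s) h = cosk2 x ij.
Proof.
by congr (snd x _); apply: val_inj; congr pair; rewrite /= permK.
Qed.

Section Comp.
Context (k : nat) (n : 'I_k -> nat) (x : cosk k) (c : forall i, cosk (n i)).

Lemma tagged_as_neq (s t : {i & 'I_(n i)}) :
  s != t -> tag s = tag t -> tagged_as t s != tagged t.
Proof.
case: s t => [i p] [j q] /= + ij; subst j.
by rewrite eq_Tagged /= tagged_asE.
Qed.

(** This mirrors [restr2_comp_same] and [restr2_comp_diff]: two inputs in one block see the unary
    part of the outer operation, two inputs in different blocks see its binary part. Matching on
    [eqVneq] supplies the proof that [cosk2] requires in either case. *)
Definition cosk_pair (s t : {i & 'I_(n i)}) (st : s != t) : bp B :=
  match eqVneq (tag s) (tag t) with
  | EqNotNeq e => bl (x.1 (tag t)) (cosk2 (c (tag t)) (tagged_as_neq st e))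
  | NeqNotEq ne => br (cosk2 x ne) ((c (tag s)).1 (tagged s)) ((c (tag t)).1 (tagged t))
  end.

Lemma sig_neq (d : offdiag (\sum_i n i)) : sig (val d).1 != sig (val d).2.
Proof. by rewrite (inj_eq (@sig_inj _ _)); exact: (valP d). Qed.

Definition cosk_comp : cosk (\sum_i n i) :=
  (fun u => bmul (x.1 (sig1 u)) ((c (sig1 u)).1 (sig2 u)),
   fun d => cosk_pair (sig_neq d)).

Lemma cosk1_comp i (p : 'I_(n i)) :
  cosk_comp.1 (Rank i p) = bmul (x.1 i) ((c i).1 p).
Proof. exact: (sig_Rank (fun i p => bmul (x.1 i) ((c i).1 p))). Qed.

Lemma cosk_pair_same i (p q : 'I_(n i))
    (h : Tagged (fun i => 'I_(n i)) p != Tagged (fun i => 'I_(n i)) q)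
    (pq : p != q) :
  cosk_pair h = bl (x.1 i) (cosk2 (c i) pq).
Proof.
rewrite /cosk_pair; case: eqVneq => [e|/eqP//]; congr bl; apply: cosk2_eq => //=.
exact: (@tagged_asE _ (fun i => 'I_(n i)) (Tagged _ q) p).
Qed.

Lemma cosk_pair_diff i j (p : 'I_(n i)) (q : 'I_(n j))
    (h : Tagged (fun i => 'I_(n i)) p != Tagged (fun i => 'I_(n i)) q)
    (ij : i != j) :
  cosk_pair h = br (cosk2 x ij) ((c i).1 p) ((c j).1 q).
Proof.
rewrite /cosk_pair; case: eqVneq => [e|ne]; first by case/eqP: ij.
by congr (br _ _ _); exact: cosk2_eq.
Qed.

Lemma cosk2_comp_pair (u v : 'I_(\sum_i n i)) (h : u != v)
    (s t : {i & 'I_(n i)}) (st : s != t) :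
  sig u = s -> sig v = t -> cosk2 cosk_comp h = cosk_pair st.
Proof.
by move=> us vt; subst s t; congr cosk_pair; exact: bool_irrelevance.
Qed.

Lemma cosk2_comp_same i (p q : 'I_(n i)) (h : Rank i p != Rank i q) (pq : p != q) :
  cosk2 cosk_comp h = bl (x.1 i) (cosk2 (c i) pq).
Proof.
have st : Tagged (fun i => 'I_(n i)) p != Tagged (fun i => 'I_(n i)) q.
  by rewrite eq_Tagged.
by rewrite (cosk2_comp_pair _ st) /Rank ?rankK // (cosk_pair_same _ pq).
Qed.

Lemma cosk2_comp_diff i j (p : 'I_(n i)) (q : 'I_(n j)) (h : Rank i p != Rank j q)
    (ij : i != j) :
  cosk2 cosk_comp h = br (cosk2 x ij) ((c i).1 p) ((c j).1 q).
Proof.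
have st : Tagged (fun i => 'I_(n i)) p != Tagged (fun i => 'I_(n i)) q.
  by apply: contra_neq ij => /(congr1 tag).
by rewrite (cosk2_comp_pair _ st) /Rank ?rankK // (cosk_pair_diff _ ij).
Qed.

End Comp.

Lemma cosk_act_continuous n (s : 'S_n) : continuous (fun x => cosk_act x s).
Proof.
apply: cosk_continuous => [|i|i j ij]; first exact: kspace_kify.
  exact: (@cosk1_continuous n).
exact: cosk2_continuous.
Qed.

Lemma cosk_comp_continuous k (n : 'I_k -> nat) :
  continuous (fun p : kprod (cosk k) (prod_topology (fun i => cosk (n i))) =>
    cosk_comp p.1 p.2).
Proof.
set Z := kprod _ _; have kZ : kspace Z by exact: kspace_kify.
have c1 : continuous (fun p : Z => p.1) by exact: kprod_fst_continuous.
have c2 i : continuous (fun p : Z => p.2 i) by exact: kprod_proj_continuous.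
have c11 i : continuous (fun p : Z => p.1.1 i).
  exact: (continuous_compose c1 (@cosk1_continuous _ i)).
have c1p i j (ij : i != j) : continuous (fun p : Z => cosk2 p.1 ij).
  exact: (continuous_compose c1 (@cosk2_continuous _ _ _ ij)).
have c21 i j : continuous (fun p : Z => (p.2 i).1 j).
  exact: (continuous_compose (c2 i) (@cosk1_continuous _ j)).
have c2p i j j' (jj : j != j') : continuous (fun p : Z => cosk2 (p.2 i) jj).
  exact: (continuous_compose (c2 i) (@cosk2_continuous _ _ _ jj)).
apply: cosk_continuous => // [u|u v uv].
  exact: (continuous_compose (kprod_pair_continuous kZ (c11 _) (c21 _ _))
    (@bmul_continuous B)).
rewrite /cosk2 /= /cosk_pair; case: eqVneq => [e|ne].
  exact: (continuous_compose (kprod_pair_continuous kZ (c2p _ _ _ _) (c11 _))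
    (@bl_continuous B)).
exact: (continuous_compose (kprod_pair_continuous kZ (c1p _ _ _)
  (kprod_pair_continuous kZ (c21 _ _) (c21 _ _))) (@br_continuous B)).
Qed.

End Cosk.



(** * The operad axioms for the coskeleton *)

Section CoskOperad.
Context (B : bimodule).
Local Notation cosk := (cosk B).

Lemma cosk_act1 n (x : cosk n) : cosk_act x 1%g = x.
Proof.
apply: cosk_ext => [i|i j ij]; first by rewrite /= invg1 perm1.
have h : (1%g : 'S_n) i != (1%g : 'S_n) j by rewrite !perm1.
by rewrite -[RHS](cosk2_act x ij h); apply: cosk2_eq; rewrite perm1.
Qed.

Lemma cosk_actM n (x : cosk n) (s t : 'S_n) :
  cosk_act x (s * t)%g = cosk_act (cosk_act x s) t.
Proof.
apply: cosk_ext => [i|i j ij]; first by rewrite /= invMg permM.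
by congr (snd x _); apply: val_inj; congr pair; rewrite /= invMg permM.
Qed.

Lemma cosk1_cast m n (e : m = n) (x : cosk m) i :
  (cast_arity cosk e x).1 i = x.1 (cast_ord (esym e) i).
Proof. by case: n / e i => i; rewrite cast_ord_id. Qed.

Lemma cosk2_cast m n (e : m = n) (x : cosk m) i j (ij : i != j) i' j' (ij' : i' != j') :
  i = cast_ord (esym e) i' -> j = cast_ord (esym e) j' ->
  cosk2 (cast_arity cosk e x) ij' = cosk2 x ij.
Proof.
case: n / e i' j' ij' => i' j' ij' ? ?; subst i j.
by apply: cosk2_eq; rewrite cast_ord_id.
Qed.

Lemma cosk_comp_1l n (x : cosk n) :
  Tagged cosk (cosk_comp (n := fun _ : 'I_1 => n) (cosk_id B) (fun _ => x))
  = Tagged cosk x.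
Proof.
apply: cosk_Tagged => [|u j|u u' h j j' h']; first by rewrite big_ord1.
  have [i [p ->]] := RankP u; rewrite Rank_const1l => /val_inj <-.
  by rewrite cosk1_comp bmul1l.
have [i [p ?]] := RankP u; have [i' [p' ?]] := RankP u'; subst u u'.
rewrite !Rank_const1l => /val_inj ? /val_inj ?; subst j j'.
move: h; rewrite (ord1 i) (ord1 i') => h.
by rewrite (cosk2_comp_same _ _ _ h') bl1.
Qed.

Lemma cosk_comp_1r k (x : cosk k) :
  Tagged cosk (cosk_comp (n := fun _ : 'I_k => 1) x (fun _ => cosk_id B))
  = Tagged cosk x.
Proof.
apply: cosk_Tagged => [|u j|u u' h j j' h']; first by rewrite sum1_card card_ord.
  have [i [p ->]] := RankP u; rewrite Rank_const1r => /val_inj <-.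
  by rewrite cosk1_comp bmul1r.
have [i [p ?]] := RankP u; have [i' [p' ?]] := RankP u'; subst u u'.
rewrite !Rank_const1r => /val_inj ? /val_inj ?; subst j j'.
by rewrite (cosk2_comp_diff _ _ _ h') br1.
Qed.

(** For a pair of inputs, the level at which they part decides which axiom applies: [brA] if in [b],
    [blr] if in [c], [blA] if only in [d]. *)
Lemma cosk_compA k (n : 'I_k -> nat) (m : 'I_(\sum_i n i) -> nat)
    (b : cosk k) (c : forall i, cosk (n i)) (d : forall u, cosk (m u)) :
  Tagged cosk (cosk_comp (cosk_comp b c) d)
  = Tagged cosk
      (cosk_comp (n := fun i => \sum_p m (Rank i p)) b
         (fun i => cosk_comp (n := fun p => m (Rank i p)) (c i)
            (fun p => d (Rank i p)))).
Proof.
apply: cosk_Tagged => [|u v|u u' h v v' h'].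
- by rewrite (big_Rank xpredT).
- have [w [r ?]] := RankP u; subst u; have [i [p ?]] := RankP w; subst w.
  rewrite RankA => /val_inj <-.
  by rewrite !cosk1_comp bmulA.
- have [w [r ?]] := RankP u; subst u; have [i [p ?]] := RankP w; subst w.
  have [w' [r' ?]] := RankP u'; subst u'; have [i' [p' ?]] := RankP w'; subst w'.
  rewrite !RankA => /val_inj ? /val_inj ?; subst v v'.
  have [ii|ii] := eqVneq i i'; last first.
    have hR : Rank i p != Rank i' p' by rewrite Rank_eq (negPf ii).
    by rewrite (cosk2_comp_diff _ _ _ hR) (cosk2_comp_diff _ _ _ ii)
      (cosk2_comp_diff _ _ _ ii) brA !cosk1_comp.
  subst i'; have hP : Rank p r != Rank (p_ := fun p => m (Rank i p)) p' r'.
    by rewrite -(Rank_eq_same (n := fun i => \sum_p m (Rank i p))).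
  rewrite (cosk2_comp_same _ _ _ hP).
  have [pp|pp] := eqVneq p p'; last first.
    have hR : Rank i p != Rank i p' by rewrite Rank_eq_same.
    by rewrite (cosk2_comp_diff _ _ _ hR) (cosk2_comp_same _ _ _ pp)
      (cosk2_comp_diff _ _ _ pp) blr.
  subst p'; have hr : r != r'.
    by rewrite -(Rank_eq_same (n := fun p => m (Rank i p))).
  by rewrite (cosk2_comp_same _ _ _ hr) cosk1_comp
    (cosk2_comp_same (n := fun p => m (Rank i p)) _ _ _ hr) blA.
Qed.

Lemma block_permE k (n : 'I_k -> nat) (s : 'S_k) i (p : 'I_(n (s i))) :
  block_perm n s (cast_ord (block_card n s) (Rank (p_ := fun i => n (s i)) i p))
  = Rank (s i) p.
Proof.
rewrite /block_perm /ord_perm permE /= cast_ord_comp cast_ord_id /block_fun.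
exact: (sig_Rank (n := fun i => n (s i)) (fun i p => Rank (s i) p)).
Qed.

(** Every input has this form, so coordinates need to be compared only where [cosk1_act] and
    [cosk2_act] apply. *)
Lemma block_permP k (n : 'I_k -> nat) (s : 'S_k) (u : 'I_(\sum_i n i)) :
  exists i (p : 'I_(n (s i))), u =
    block_perm n s (cast_ord (block_card n s) (Rank (p_ := fun i => n (s i)) i p)).
Proof.
have [j [p ->]] := RankP u; move: p; rewrite -(permKV s j) => p.
by exists (s^-1%g j), p; rewrite block_permE.
Qed.

Lemma cosk_comp_actl k (n : 'I_k -> nat) (b : cosk k) (s : 'S_k)
    (c : forall i, cosk (n i)) :
  cosk_comp (cosk_act b s) c
  = cosk_act
      (cast_arity cosk (block_card n s)
         (cosk_comp (n := fun i => n (s i)) b (fun i => c (s i))))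
      (block_perm n s).
Proof.
apply: cosk_ext => [u|u u' h].
  have [i [p ->]] := block_permP s u.
  rewrite cosk1_act cosk1_cast cast_ord_comp cast_ord_id block_permE.
  by rewrite !cosk1_comp cosk1_act.
have [i [p ?]] := block_permP s u; have [i' [p' ?]] := block_permP s u'; subst u u'.
have hR : Rank (p_ := fun i => n (s i)) i p != Rank (p_ := fun i => n (s i)) i' p'.
  by apply: contra_neq h => ->.
have hC : cast_ord (block_card n s) (Rank (p_ := fun i => n (s i)) i p)
    != cast_ord (block_card n s) (Rank (p_ := fun i => n (s i)) i' p').
  by apply: contra_neq h => ->.
rewrite (cosk2_act _ hC) (@cosk2_cast _ _ _ _ _ _ hR);
  [|by rewrite cast_ord_comp cast_ord_id..].
have hS : Rank (s i) p != Rank (s i') p' by rewrite -!block_permE.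
have -> : cosk2 (cosk_comp (cosk_act b s) c) h = cosk2 (cosk_comp (cosk_act b s) c) hS.
  by apply: cosk2_eq; rewrite block_permE.
have [ii|ii] := eqVneq i i'; last first.
  have sii : s i != s i' by rewrite (inj_eq perm_inj).
  by rewrite (cosk2_comp_diff _ _ _ ii) (cosk2_comp_diff _ _ _ sii) (cosk2_act _ ii).
subst i'; have pp : p != p' by rewrite -(Rank_eq_same (n := n)).
by rewrite (cosk2_comp_same (n := n) _ _ _ pp) cosk1_act
  (cosk2_comp_same (n := fun i => n (s i)) _ _ _ pp).
Qed.

Lemma dsum_permE k (n : 'I_k -> nat) (t : forall i, 'S_(n i)) i (p : 'I_(n i)) :
  dsum_perm t (Rank i p) = Rank i (t i p).
Proof.
rewrite /dsum_perm permE /dsum_fun.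
exact: (sig_Rank (fun i p => Rank i (t i p))).
Qed.

Lemma cosk_comp_actr k (n : 'I_k -> nat) (b : cosk k)
    (c : forall i, cosk (n i)) (t : forall i, 'S_(n i)) :
  cosk_comp b (fun i => cosk_act (c i) (t i))
  = cosk_act (cosk_comp b c) (dsum_perm t).
Proof.
apply: cosk_ext => [u|u u' h].
  have [i [p ->]] := RankP u; rewrite -(permKV (t i) p) -dsum_permE cosk1_act.
  by rewrite dsum_permE !cosk1_comp cosk1_act.
have [i [p ?]] := RankP u; have [i' [p' ?]] := RankP u'; subst u u'.
move: h; rewrite -(permKV (t i) p) -(permKV (t i') p').
move: (_ p) (_ p') => q q' h.
have hR : Rank i q != Rank i' q'.
  by apply: contra_neq h => E; rewrite -!dsum_permE E.
have hD : dsum_perm t (Rank i q) != dsum_perm t (Rank i' q').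
  by rewrite (inj_eq perm_inj).
rewrite [RHS](cosk2_eq _ _ hD) ?dsum_permE // cosk2_act.
have [ii|ii] := eqVneq i i'; last first.
  by rewrite !(cosk2_comp_diff _ _ _ ii) !cosk1_act.
subst i'; have pp : q != q' by rewrite -(Rank_eq_same (n := n)).
have tp : t i q != t i q' by rewrite (inj_eq perm_inj).
by rewrite (cosk2_comp_same _ _ _ tp) (cosk2_comp_same _ _ _ pp) (cosk2_act _ pp).
Qed.

Definition cosk_operad : operad :=
  @Operad cosk (fun n => @kspace_kify _) (cosk_id B) (@cosk_act B)
    (fun k n => @cosk_comp B k n) (@cosk_act_continuous B)
    (@cosk_comp_continuous B) cosk_act1 cosk_actM cosk_comp_1l cosk_comp_1r
    cosk_compA cosk_comp_actl cosk_comp_actr.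

End CoskOperad.

(** * Tensor products and generation *)


Lemma map_cast (A B : operad) (F : operad_map A B) m n (e : m = n) (x : A m) :
  F _ (cast_arity A e x) = cast_arity B e (F _ x).
Proof. by case: n / e. Qed.

Definition operad_map_id (A : operad) : operad_map A A.
Proof. by exists (fun n x => x) => // n x; exact: cvg_id. Defined.

Definition operad_map_comp (A B C : operad) (F : operad_map A B)
  (G : operad_map B C) : operad_map A C.
Proof.
exists (fun n x => G n (F n x)).
- by move=> n; exact: continuous_compose (@op_map_continuous _ _ F n)
    (@op_map_continuous _ _ G n).
- by rewrite !op_map_id.
- by move=> n x s; rewrite !op_map_act.
- by move=> k n b c; rewrite !op_map_comp.
Defined.

Definition interchanging (A B X : operad) (f : operad_map A X) (g : operad_map B X) :=
  forall k l (a : A k) (b : B l),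
    op_act
      (cast_arity X (transpose_card k l)
         (op_comp (fun _ : 'I_k => l) (f k a) (fun _ => g l b)))
      (transpose_perm k l)
    = op_comp (fun _ : 'I_l => k) (g l b) (fun _ => f k a).

Definition jointly_epic (A B T : operad) (jA : operad_map A T) (jB : operad_map B T) :=
  forall (X : operad) (h h' : operad_map T X),
    (forall n x, h n (jA n x) = h' n (jA n x)) ->
    (forall n x, h n (jB n x) = h' n (jB n x)) ->
    forall n x, h n x = h' n x.

(** The existence half of the universal property of the tensor product; [jointly_epic] is the
    uniqueness half. *)
Definition tensor_extends (A B T : operad)
    (jA : operad_map A T) (jB : operad_map B T) :=
  forall (X : operad) (f : operad_map A X) (g : operad_map B X), interchanging f g ->
  exists h : operad_map T X,
    (forall n x, h n (jA n x) = f n x) /\ (forall n x, h n (jB n x) = g n x).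

(** The two universal properties are composed. Interchanging maps extend over the coproduct, the
    extension respects the relations and so factors through the quotient; uniqueness is used first
    for the coproduct and then for the quotient. *)
Lemma tensorP (A B T : operad) : is_tensor A B T ->
  exists (jA : operad_map A T) (jB : operad_map B T),
    [/\ interchanging jA jB, tensor_extends jA jB & jointly_epic jA jB].
Proof.
move=> [C [iA [iB [q [cop [qR quo]]]]]].
exists (operad_map_comp iA q), (operad_map_comp iB q); split.
- move=> k l a b; have := qR _ _ _ (Interchange iA iB a b).
  by rewrite op_map_act map_cast !op_map_comp.
- move=> X f g fg; have [h [hf hg _]] := cop X f g.
  have [|h' [hq _]] := quo X h.
    move=> n x y [k l a b].
    by rewrite op_map_act map_cast !op_map_comp hf hg.
  by exists h'; split=> n x /=; rewrite hq.
- move=> X h h' eA eB.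
  have [u [_ _ uniq_u]] := cop X (operad_map_comp (operad_map_comp iA q) h)
    (operad_map_comp (operad_map_comp iB q) h).
  have e n (x : C n) : h n (q n x) = h' n (q n x).
    have -> : h n (q n x) = u n x by exact: (uniq_u (operad_map_comp q h)).
    symmetry; apply: (uniq_u (operad_map_comp q h')) => m y /=.
      by rewrite -eA.
    by rewrite -eB.
  have [|v [_ uniq_v]] := quo X (operad_map_comp q h).
    by move=> n x y xy /=; rewrite (qR _ _ _ xy).
  move=> n x; rewrite (uniq_v h) // (uniq_v h') // => m y /=.
  by rewrite e.
Qed.

(** * Suboperads and the generation principle *)

Section Suboperad.
Context (O : operad) (S : forall n, set (O n)).
Context (S_id : S op_id).
Context (S_act : forall n (x : O n) (s : 'S_n), S x -> S (op_act x s)).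
Context (S_comp : forall k (n : 'I_k -> nat) (x : O k) (c : forall i, O (n i)),
  S x -> (forall i, S (c i)) -> S (op_comp n x c)).

Definition sub_carrier n : Type := {x : O n | `[< S x >]}.
HB.instance Definition _ n := Choice.on (sub_carrier n).

Definition sub_val n (x : sub_carrier n) : O n := val x.

Lemma sub_valP n (x : sub_carrier n) : S (sub_val x).
Proof. exact/asboolP/(valP x). Qed.

(** A subspace of a k-space need not be a k-space, so the subspace topology is k-ified. *)
Definition sub_space n : topologicalType :=
  kify (initial_topology (@sub_val n)).

Definition in_sub n (x : O n) (Sx : S x) : sub_space n :=
  exist (fun x => `[< S x >]) x (introT (asboolP _) Sx).

Lemma sub_val_continuous n : continuous (@sub_val n : sub_space n -> O n).
Proof.
exact: (continuous_compose (@kify_continuous (initial_topology (@sub_val n)))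
  (@initial_continuous _ _ (@sub_val n))).
Qed.

Lemma sub_continuous (Z : topologicalType) n (f : Z -> sub_space n) :
  kspace Z -> continuous (fun z => sub_val (f z)) -> continuous f.
Proof.
move=> kZ cf; apply: kspace_continuous_kify => //.
exact: continuous_comp_initial.
Qed.

Lemma sub_Tagged m n (x : sub_space m) (y : sub_space n) :
  Tagged (op_space O) (sub_val x) = Tagged (op_space O) (sub_val y) ->
  Tagged sub_space x = Tagged sub_space y.
Proof.
move/Tagged_cast => [e]; case: n / e y => y xy.
by congr Tagged; exact: val_inj.
Qed.

Lemma sub_cast m n (e : m = n) (x : sub_space m) :
  sub_val (cast_arity sub_space e x) = cast_arity O e (sub_val x).
Proof. by case: n / e. Qed.

Definition sub_act n (x : sub_space n) (s : 'S_n) : sub_space n :=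
  in_sub (S_act s (sub_valP x)).

Definition sub_comp k (n : 'I_k -> nat) (x : sub_space k)
    (c : forall i, sub_space (n i)) : sub_space (\sum_i n i) :=
  in_sub (S_comp (sub_valP x) (fun i => sub_valP (c i))).

Definition suboperad : operad.
Proof.
apply: (@Operad sub_space _ (in_sub S_id) sub_act sub_comp).
- by move=> n; exact: kspace_kify.
- move=> n s; apply: sub_continuous; first exact: kspace_kify.
  exact: continuous_compose (@sub_val_continuous n) (@op_act_continuous O n s).
- move=> k n; apply: sub_continuous; first exact: kspace_kify.
  apply: op_comp_continuous_fun; first exact: kspace_kify.
    apply: continuous_compose (@sub_val_continuous k); exact: kprod_fst_continuous.
  move=> i.
  apply: continuous_compose (@sub_val_continuous (n i)).
  exact: (kprod_proj_continuous (Y := fun i => sub_space (n i))).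
- by move=> n x; apply: val_inj; exact: op_act1.
- by move=> n x s t; apply: val_inj; exact: op_actM.
- by move=> n x; apply: sub_Tagged; exact: op_comp1l.
- by move=> n x; apply: sub_Tagged; exact: op_comp1r.
- by move=> k n m b c d; apply: sub_Tagged; exact: op_compA.
- move=> k n b s c; apply: val_inj.
  rewrite [LHS]op_comp_actl; congr op_act; symmetry; exact: sub_cast.
- by move=> k n b c t; apply: val_inj; exact: op_comp_actr.
Defined.

Definition sub_incl : operad_map suboperad O.
Proof.
by exists (fun n (x : suboperad n) => sub_val x) => // n; exact: sub_val_continuous.
Defined.

Definition sub_lift (A : operad) (F : operad_map A O) (SF : forall n x, S (F n x)) :
  operad_map A suboperad.
Proof.
exists (fun n x => in_sub (SF n x)).
- move=> n; apply: sub_continuous; first exact: op_kspace.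
  exact: op_map_continuous.
- by apply: val_inj; exact: op_map_id.
- by move=> n x s; apply: val_inj; exact: op_map_act.
- by move=> k n b c; apply: val_inj; exact: op_map_comp.
Defined.

(** The maps from [A] and [B] lift to the suboperad and still interchange, hence extend to a map
    from [O] into it. Followed by the inclusion, this agrees with the identity on [A] and [B], so it
    is the identity. *)
Lemma generation (A B : operad) (jA : operad_map A O) (jB : operad_map B O) :
  interchanging jA jB -> tensor_extends jA jB -> jointly_epic jA jB ->
  (forall n x, S (jA n x)) -> (forall n x, S (jB n x)) ->
  forall n (x : O n), S x.
Proof.
move=> ic ext epi SA SB n x.
have [|h [hA hB]] := ext suboperad (sub_lift SA) (sub_lift SB).
  move=> k l a b; apply: val_inj; rewrite [RHS]/= -[RHS]ic.
  by congr op_act; exact: sub_cast.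
have -> : x = sub_val (h n x); last exact: sub_valP.
apply: (epi O (operad_map_id O) (operad_map_comp h sub_incl)) => m y /=.
  by rewrite hA.
by rewrite hB.
Qed.

End Suboperad.

(** * The pushout as a bimodule *)


Local Open Scope quotient_scope.

Section PushoutTheory.
Context {X Y Z : topologicalType} (f : X -> Y) (g : X -> Z).
Local Notation P := (pushout f g).

Definition pushout_summand (b : bool) : topologicalType := if b then Y else Z.

Definition pushout_in (b : bool) (y : pushout_summand b) : P :=
  \pi_({eq_quot (pushout_equiv f g)}) (existT pushout_summand b y).

Definition pushout_in1 (y : Y) : P := @pushout_in true y.
Definition pushout_in2 (z : Z) : P := @pushout_in false z.

Lemma pushout_glue x : pushout_in1 (f x) = pushout_in2 (g x).
Proof.
apply/eqmodP/asboolP; apply: Relation_Operators.rst_step; exact: PushoutStep.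
Qed.

Lemma pushout_in_surj (p : P) : exists b y, @pushout_in b y = p.
Proof.
by exists (projT1 (generic_quotient.repr p)), (projT2 (generic_quotient.repr p));
  rewrite -[RHS]reprK /pushout_in; case: (generic_quotient.repr p).
Qed.

Lemma pushout_ind (Q : P -> Prop) :
  (forall y, Q (pushout_in1 y)) -> (forall z, Q (pushout_in2 z)) -> forall p, Q p.
Proof. by move=> h1 h2 p; have [[] [y <-]] := pushout_in_surj p. Qed.

Lemma pushout_in_continuous b : continuous (@pushout_in b).
Proof.
exact: (continuous_compose (@existT_continuous _ pushout_summand b)
  (@pi_continuous _ _)).
Qed.

Lemma pushout_open (V : set P) :
  (forall b, open (@pushout_in b @^-1` V)) -> open V.
Proof. by move=> h; apply/sigT_openP => b; exact: h. Qed.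

Section Rec.
Context (W : Type) (u : Y -> W) (v : Z -> W) (uv : forall x, u (f x) = v (g x)).

Definition pushout_sum_rec (s : @pushout_sum Y Z) : W :=
  match s with
  | existT b y => (if b return pushout_summand b -> W then u else v) y
  end.

Definition pushout_rec (p : P) : W := pushout_sum_rec (generic_quotient.repr p).

(** The value at a chosen representative is the value at any other: agreement on glued points passes
    to the generated equivalence relation by induction. *)
Lemma pushout_rec_in b y :
  pushout_rec (@pushout_in b y) = pushout_sum_rec (existT _ b y).
Proof.
rewrite /pushout_rec.
have /eqmodP/asboolP :
    generic_quotient.repr (@pushout_in b y) = existT pushout_summand b y
    %[mod {eq_quot (pushout_equiv f g)}] by rewrite reprK.
elim=> [s t [x]|s|s t _ ->|s t r _ -> _ ->] //=.
Qed.

Lemma pushout_rec1 y : pushout_rec (pushout_in1 y) = u y.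
Proof. exact: pushout_rec_in. Qed.

Lemma pushout_rec2 z : pushout_rec (pushout_in2 z) = v z.
Proof. exact: pushout_rec_in. Qed.

End Rec.

(** Used for actions on the pushout, which must be continuous jointly in the point and the acting
    element. *)
Lemma pushout_kprod_continuous (V W : topologicalType) (F : P -> V -> W) :
  kspace Y -> kspace Z ->
  continuous (fun u : kprod Y V => F (pushout_in1 u.1) u.2) ->
  continuous (fun u : kprod Z V => F (pushout_in2 u.1) u.2) ->
  continuous (fun u : kprod P V => F u.1 u.2).
Proof.
move=> kY kZ c1 c2.
apply: (@kprod_final bool pushout_summand P V W pushout_in F).
- by case.
- exact: pushout_in_surj.
- exact: pushout_open.
- by case.
Qed.

Lemma pushout_continuous (W : topologicalType) (F : P -> W) :
  continuous (fun y => F (pushout_in1 y)) -> continuous (fun z => F (pushout_in2 z)) ->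
  continuous F.
Proof.
move=> /continuousP c1 /continuousP c2; apply/continuousP => U oU.
by apply: pushout_open => -[]; [exact: c1|exact: c2].
Qed.

End PushoutTheory.

Lemma kprod_fst_comp (X Y Z : topologicalType) (h : Z -> kprod X Y) :
  continuous h -> continuous (fun z => (h z).1).
Proof. by move=> ch; exact: continuous_compose ch (@kprod_fst_continuous X Y). Qed.

Lemma kprod_snd_comp (X Y Z : topologicalType) (h : Z -> kprod X Y) :
  continuous h -> continuous (fun z => (h z).2).
Proof. by move=> ch; exact: continuous_compose ch (@kprod_snd_continuous X Y). Qed.

(** * The monoid and the bimodule built from two operads *)

Section TensorBimodule.
Context (A B : operad) (zA : A 0) (zB : B 0).
Context (hA : forall x : A 0, x = zA) (hB : forall y : B 0, y = zB).

(** A pair (a, b) stands for [a o b] in the tensor product, an element of [binaryA] for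
    [a o (b + b')] and one of [binaryB] for [b o (a + a')]. *)
Definition unaryAB : topologicalType := kprod (A 1) (B 1).
Definition binaryA : topologicalType := kprod (A 2) (kprod (B 1) (B 1)).
Definition binaryB : topologicalType := kprod (kprod (A 1) (A 1)) (B 2).
Definition binaryAB : topologicalType :=
  pushout (restrict_snd (A := A) zB) (restrict_fst (B := B) zA).

Definition inA : binaryA -> binaryAB := pushout_in1 _ _.
Definition inB : binaryB -> binaryAB := pushout_in2 _ _.

Lemma glueAB (a : A 2) (b : B 2) :
  inA (a, (restr1 zB b ord0, restr1 zB b ord_max))
  = inB ((restr1 zA a ord0, restr1 zA a ord_max), b).
Proof.
have := pushout_glue (restrict_snd (A := A) zB) (restrict_fst (B := B) zA) (a, b).
by rewrite /restrict_snd /restrict_fst /= !(restrictE hA) !(restrictE hB).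
Qed.

Definition mulAB (m m' : unaryAB) : unaryAB := (lmul m.1 m'.1, lmul m.2 m'.2).

(** The four formulas are what interchange forces. For instance, [a1 o b1 o a o (b + b')] equals
    [a1 o a o (b1 o b + b1 o b')], as [b1] moves past [a] to both inputs. *)
Definition lactA (m : unaryAB) (y : binaryA) : binaryA :=
  (lmul m.1 y.1, (lmul m.2 y.2.1, lmul m.2 y.2.2)).
Definition lactB (m : unaryAB) (z : binaryB) : binaryB :=
  ((lmul m.1 z.1.1, lmul m.1 z.1.2), lmul m.2 z.2).
Definition ractA (y : binaryA) (m m' : unaryAB) : binaryA :=
  (rmul y.1 (pair2 m.1 m'.1), (lmul y.2.1 m.2, lmul y.2.2 m'.2)).
Definition ractB (z : binaryB) (m m' : unaryAB) : binaryB :=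
  ((lmul z.1.1 m.1, lmul z.1.2 m'.1), rmul z.2 (pair2 m.2 m'.2)).

Definition lactAB (m : unaryAB) : binaryAB -> binaryAB :=
  pushout_rec (inA \o lactA m) (inB \o lactB m).
Definition ractAB (p : binaryAB) (m m' : unaryAB) : binaryAB :=
  pushout_rec (fun y => inA (ractA y m m')) (fun z => inB (ractB z m m')) p.

(** The recursion is well defined because restriction commutes with left multiplication: the two
    points glued for [(a, b)] go to those glued for [(lmul m.1 a, lmul m.2 b)]. *)
Lemma lactAB_inA m y : lactAB m (inA y) = inA (lactA m y).
Proof.
apply: pushout_rec1 => -[a b]; rewrite /restrict_snd /restrict_fst /=.
rewrite !(restrictE hA) !(restrictE hB) /lactA /lactB /=.
rewrite -(restr1_lmul hA) -(restr1_lmul hA).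
by rewrite -(restr1_lmul hB) -(restr1_lmul hB) glueAB.
Qed.

Lemma lactAB_inB m z : lactAB m (inB z) = inB (lactB m z).
Proof.
apply: pushout_rec2 => -[a b]; rewrite /restrict_snd /restrict_fst /=.
rewrite !(restrictE hA) !(restrictE hB) /lactA /lactB /=.
rewrite -(restr1_lmul hA) -(restr1_lmul hA).
by rewrite -(restr1_lmul hB) -(restr1_lmul hB) glueAB.
Qed.

(** Restricting after right multiplication multiplies each restriction by its own factor, so the
    claim is the gluing for the two multiplied operations. *)
Lemma ractAB_glue m m' (x : kprod (A 2) (B 2)) :
  inA (ractA (restrict_snd zB x) m m') = inB (ractB (restrict_fst zA x) m m').
Proof.
case: x => a b; rewrite /restrict_snd /restrict_fst /=.
rewrite !(restrictE hA) !(restrictE hB) /ractA /ractB /=.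
have := glueAB (rmul a (pair2 m.1 m'.1)) (rmul b (pair2 m.2 m'.2)).
by rewrite !(restr1_rmul hA) !(restr1_rmul hB).
Qed.

Lemma ractAB_inA y m m' : ractAB (inA y) m m' = inA (ractA y m m').
Proof. by apply: pushout_rec1 => x; exact: ractAB_glue. Qed.

Lemma ractAB_inB z m m' : ractAB (inB z) m m' = inB (ractB z m m').
Proof. by apply: pushout_rec2 => x; exact: ractAB_glue. Qed.

Lemma binaryAB_ind (Q : binaryAB -> Prop) :
  (forall y, Q (inA y)) -> (forall z, Q (inB z)) -> forall p, Q p.
Proof. exact: pushout_ind. Qed.

Lemma inA_continuous : continuous inA.
Proof. exact: (@pushout_in_continuous _ _ _ _ _ true). Qed.

Lemma inB_continuous : continuous inB.
Proof. exact: (@pushout_in_continuous _ _ _ _ _ false). Qed.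

Lemma mulAB_continuous : continuous (fun u : kprod unaryAB unaryAB => mulAB u.1 u.2).
Proof.
have k := @kspace_kify (unaryAB * unaryAB)%type.
have c1 : continuous (fun u : kprod unaryAB unaryAB => u.1).
  exact: kprod_fst_continuous.
have c2 : continuous (fun u : kprod unaryAB unaryAB => u.2).
  exact: kprod_snd_continuous.
by apply: kprod_pair_continuous => //; apply: lmul_continuous => //;
  solve [exact: kprod_fst_comp|exact: kprod_snd_comp].
Qed.

Lemma lactAB_continuous : continuous (fun u : kprod binaryAB unaryAB => lactAB u.2 u.1).
Proof.
apply: (pushout_kprod_continuous (F := fun p m => lactAB m p)).
- exact: kspace_kify.
- exact: kspace_kify.
- under eq_fun do rewrite -/(inA _) lactAB_inA.
  apply: (continuous_compose (f := fun u : kprod binaryA unaryAB => lactA u.2 u.1))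
    inA_continuous.
  have k := @kspace_kify (binaryA * unaryAB)%type.
  have c1 := @kprod_fst_continuous binaryA unaryAB.
  have c2 := @kprod_snd_continuous binaryA unaryAB.
  have c11 := kprod_fst_comp c1; have c12 := kprod_snd_comp c1.
  have c21 := kprod_fst_comp c2; have c22 := kprod_snd_comp c2.
  have c121 := kprod_fst_comp c12; have c122 := kprod_snd_comp c12.
  apply: kprod_pair_continuous => //; first exact: lmul_continuous.
  by apply: kprod_pair_continuous => //; exact: lmul_continuous.
- under eq_fun do rewrite -/(inB _) lactAB_inB.
  apply: (continuous_compose (f := fun u : kprod binaryB unaryAB => lactB u.2 u.1))
    inB_continuous.
  have k := @kspace_kify (binaryB * unaryAB)%type.
  have c1 := @kprod_fst_continuous binaryB unaryAB.
  have c2 := @kprod_snd_continuous binaryB unaryAB.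
  have c11 := kprod_fst_comp c1; have c12 := kprod_snd_comp c1.
  have c21 := kprod_fst_comp c2; have c22 := kprod_snd_comp c2.
  have c111 := kprod_fst_comp c11; have c112 := kprod_snd_comp c11.
  apply: kprod_pair_continuous => //; last exact: lmul_continuous.
  by apply: kprod_pair_continuous => //; exact: lmul_continuous.
Qed.

Lemma pair2_continuous (W V : topologicalType) (s t : W -> V) :
  continuous s -> continuous t -> forall i, continuous (fun w => pair2 (s w) (t w) i).
Proof. by move=> cs ct i; rewrite /pair2; case: (i == ord0). Qed.

Lemma ractAB_continuous :
  continuous (fun u : kprod binaryAB (kprod unaryAB unaryAB) => ractAB u.1 u.2.1 u.2.2).
Proof.
apply: (pushout_kprod_continuous
  (F := fun p (m : kprod unaryAB unaryAB) => ractAB p m.1 m.2)).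
- exact: kspace_kify.
- exact: kspace_kify.
- under eq_fun do rewrite -/(inA _) ractAB_inA.
  apply: (continuous_compose (f := fun u : kprod binaryA (kprod unaryAB unaryAB) =>
    ractA u.1 u.2.1 u.2.2)) inA_continuous.
  have k := @kspace_kify (binaryA * kprod unaryAB unaryAB)%type.
  have c1 := @kprod_fst_continuous binaryA (kprod unaryAB unaryAB).
  have c2 := @kprod_snd_continuous binaryA (kprod unaryAB unaryAB).
  have c11 := kprod_fst_comp c1; have c12 := kprod_snd_comp c1.
  have c21 := kprod_fst_comp c2; have c22 := kprod_snd_comp c2.
  have c121 := kprod_fst_comp c12; have c122 := kprod_snd_comp c12.
  have c211 := kprod_fst_comp c21; have c212 := kprod_snd_comp c21.
  have c221 := kprod_fst_comp c22; have c222 := kprod_snd_comp c22.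
  apply: kprod_pair_continuous => //.
    by apply: rmul_continuous => //; exact: pair2_continuous.
  by apply: kprod_pair_continuous => //; exact: lmul_continuous.
- under eq_fun do rewrite -/(inB _) ractAB_inB.
  apply: (continuous_compose (f := fun u : kprod binaryB (kprod unaryAB unaryAB) =>
    ractB u.1 u.2.1 u.2.2)) inB_continuous.
  have k := @kspace_kify (binaryB * kprod unaryAB unaryAB)%type.
  have c1 := @kprod_fst_continuous binaryB (kprod unaryAB unaryAB).
  have c2 := @kprod_snd_continuous binaryB (kprod unaryAB unaryAB).
  have c11 := kprod_fst_comp c1; have c12 := kprod_snd_comp c1.
  have c21 := kprod_fst_comp c2; have c22 := kprod_snd_comp c2.
  have c111 := kprod_fst_comp c11; have c112 := kprod_snd_comp c11.
  have c211 := kprod_fst_comp c21; have c212 := kprod_snd_comp c21.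
  have c221 := kprod_fst_comp c22; have c222 := kprod_snd_comp c22.
  apply: kprod_pair_continuous => //; last first.
    by apply: rmul_continuous => //; exact: pair2_continuous.
  by apply: kprod_pair_continuous => //; exact: lmul_continuous.
Qed.

Lemma pair2_same (T : Type) (a : T) : pair2 a a = fun=> a.
Proof. by apply/funext => i; rewrite /pair2 if_same. Qed.

Lemma pair2_lmul (O : operad) (a b a' b' : O 1) :
  (fun i => lmul (pair2 a b i) (pair2 a' b' i)) = pair2 (lmul a a') (lmul b b').
Proof. by apply/funext => i; rewrite /pair2; case: ifP. Qed.

Lemma lmulr1 (O : operad) (a : O 1) : lmul a op_id = a.
Proof. by rewrite -(rmul_unary a (fun=> op_id)) rmul1. Qed.

Definition bimoduleAB : bimodule.
Proof.
apply: (@Bimodule unaryAB binaryAB (op_id, op_id) mulAB lactAB ractAB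
  mulAB_continuous lactAB_continuous ractAB_continuous).
- by case=> a b; rewrite /mulAB /= !lmul1.
- by case=> a b; rewrite /mulAB /= !lmulr1.
- by move=> a b c; rewrite /mulAB /= !lmulA.
- elim/binaryAB_ind => [[a [b b']]|[[a a'] b]].
    by rewrite lactAB_inA /lactA /= !lmul1.
  by rewrite lactAB_inB /lactB /= !lmul1.
- move=> m m'; elim/binaryAB_ind => y; first by rewrite !lactAB_inA /lactA /= !lmulA.
  by rewrite !lactAB_inB /lactB /= !lmulA.
- elim/binaryAB_ind => [[a [b b']]|[[a a'] b]].
    by rewrite ractAB_inA /ractA /= !lmulr1 pair2_same rmul1.
  by rewrite ractAB_inB /ractB /= !lmulr1 pair2_same rmul1.
- move=> p m n m' n'; elim/binaryAB_ind: p => y.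
    by rewrite !ractAB_inA /ractA /= !lmulA rmulA pair2_lmul.
  by rewrite !ractAB_inB /ractB /= !lmulA rmulA pair2_lmul.
- move=> m p n n'; elim/binaryAB_ind: p => y.
    by rewrite !(ractAB_inA, lactAB_inA) /ractA /lactA /= !lmulA rmul_lmul.
  by rewrite !(ractAB_inB, lactAB_inB) /ractB /lactB /= !lmulA rmul_lmul.
Defined.

End TensorBimodule.

(** * The map to the coskeleton *)


Lemma transpose_permE k l (i : 'I_k) (j : 'I_l) :
  transpose_perm k l
    (cast_ord (transpose_card k l) (Rank (p_ := fun _ : 'I_k => l) i j))
  = Rank (p_ := fun _ : 'I_l => k) j i.
Proof.
rewrite /transpose_perm /ord_perm permE /= cast_ord_comp cast_ord_id /transpose_fun.
exact: (sig_Rank (n := fun _ : 'I_k => l)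
  (fun i j => Rank (p_ := fun _ : 'I_l => k) j i)).
Qed.

Lemma eval_cast (O : operad) L m n (e : m = n) (x : O m) (E : 'I_n -> labelled O L) :
  eval (cast_arity O e x) E = eval x (fun i => E (cast_ord e i)).
Proof.
case: n / e E => E; congr eval.
by apply/funext => i; rewrite cast_ord_id.
Qed.

Lemma ord_permE m n (e : m = n) (s : 'I_m -> 'I_n) (sI : injective s) i :
  ord_perm e sI (cast_ord e i) = s i.
Proof. by rewrite /ord_perm permE /= cast_ord_comp cast_ord_id. Qed.

(** * The unary actions inside the coskeleton *)

Section CoskPlug.
Context (B : bimodule).
Local Notation X := (cosk_operad B).

Section Plug.
Context (k m : nat) (n : 'I_k -> nat) (l : forall i, 'I_(n i) -> 'I_m).
Context (c_card : \sum_i n i = m).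
Context (l_inj : injective (fun u : 'I_(\sum_i n i) => @l (sig1 u) (sig2 u))).
Context (x : X k) (c : forall i, X (n i)).

Lemma plug_ordE i (p : 'I_(n i)) :
  ord_perm c_card l_inj (cast_ord c_card (Rank i p)) = l p.
Proof. by rewrite ord_permE (sig_Rank l). Qed.

Lemma cosk1_plug i (p : 'I_(n i)) :
  (plug c_card l_inj x c : cosk B m).1 (l p) = bmul (x.1 i) ((c i).1 p).
Proof.
rewrite -plug_ordE /plug [LHS]cosk1_act [LHS]cosk1_cast cast_ord_comp cast_ord_id.
exact: cosk1_comp.
Qed.

Lemma cosk2_plug i (p : 'I_(n i)) j (q : 'I_(n j)) (h : l p != l q)
    (pq : Rank i p != Rank j q) :
  cosk2 (plug c_card l_inj x c : cosk B m) h = cosk2 (cosk_comp x c) pq.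
Proof.
have hc : cast_ord c_card (Rank i p) != cast_ord c_card (Rank j q).
  by rewrite (inj_eq (@cast_ord_inj _ _ _)).
have ho : ord_perm c_card l_inj (cast_ord c_card (Rank i p))
    != ord_perm c_card l_inj (cast_ord c_card (Rank j q)).
  by rewrite !plug_ordE.
transitivity (cosk2 (plug c_card l_inj x c : cosk B m) ho).
  by apply: cosk2_eq; rewrite plug_ordE.
rewrite /plug [LHS](cosk2_act _ hc).
by apply: cosk2_cast; rewrite cast_ord_comp cast_ord_id.
Qed.

End Plug.

Lemma cosk1_lmul n (x : X 1) (y : X n) (p : 'I_n) :
  (lmul x y : cosk B n).1 p = bmul ((x : cosk B 1).1 ord0) ((y : cosk B n).1 p).
Proof. exact: (@cosk1_plug 1 n (fun=> n) (fun=> id) _ _ x (fun=> y) ord0 p). Qed.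

Lemma cosk2_rmul (x : X 2) (y0 y1 : X 1) (h : ord0 != ord_max :> 'I_2) :
  cosk2 (rmul x (pair2 y0 y1) : cosk B 2) h
  = br (cosk2 (x : cosk B 2) h) ((y0 : cosk B 1).1 ord0) ((y1 : cosk B 1).1 ord0).
Proof.
have hR : Rank (p_ := fun _ : 'I_2 => 1) ord0 ord0
    != Rank (p_ := fun _ : 'I_2 => 1) ord_max ord0 by rewrite Rank_eq.
rewrite [LHS](@cosk2_plug 2 2 (fun=> 1) (fun i _ => i) _ _ x (pair2 y0 y1)
  ord0 ord0 ord_max ord0 h hR).
by rewrite (cosk2_comp_diff _ _ _ h).
Qed.

End CoskPlug.

Section CoskMaps.
Context (A B : operad) (zA : A 0) (zB : B 0).
Context (hA : forall x : A 0, x = zA) (hB : forall y : B 0, y = zB).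
Local Notation bim := (bimoduleAB hA hB).
Local Notation X := (cosk_operad bim).

(** An operation of [A] alone has units in all its [B] components. *)
Definition cosk_mapA_fun n (a : A n) : cosk bim n :=
  (fun i => (restr1 zA a i, op_id) : unaryAB A B,
   fun d => inA zA zB (restr2 zA a (valP d), (op_id, op_id))).

Definition cosk_mapB_fun n (b : B n) : cosk bim n :=
  (fun i => (op_id, restr1 zB b i) : unaryAB A B,
   fun d => inB zA zB ((op_id, op_id), restr2 zB b (valP d))).

Lemma cosk2_mapA n (a : A n) i j (ij : i != j) :
  cosk2 (cosk_mapA_fun a) ij = inA zA zB (restr2 zA a ij, (op_id, op_id)).
Proof.
rewrite /cosk2 /=; congr (inA _ _ (restr2 _ _ _, _)); exact: bool_irrelevance.
Qed.

Lemma cosk2_mapB n (b : B n) i j (ij : i != j) :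
  cosk2 (cosk_mapB_fun b) ij = inB zA zB ((op_id, op_id), restr2 zB b ij).
Proof.
rewrite /cosk2 /=; congr (inB _ _ (_, restr2 _ _ _)); exact: bool_irrelevance.
Qed.

(** Compatibility with composition is the set of rules for restricting a composite, once the units
    in the [B] components are cancelled. *)
Definition cosk_mapA : operad_map A X.
Proof.
exists cosk_mapA_fun.
- move=> n; apply: cosk_continuous => [|i|i j ij]; first exact: op_kspace.
    apply: kprod_pair_continuous; first exact: op_kspace.
      exact: restr1_continuous.
    by move=> ?; exact: cvg_cst.
  under eq_fun do rewrite cosk2_mapA.
  apply: (continuous_compose
      (f := fun a : A n => (restr2 zA a ij, (op_id, op_id)) : binaryA A B))
    (@inA_continuous _ _ _ _).
  apply: kprod_pair_continuous; [exact: op_kspace|exact: restr2_continuous|].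
  by move=> ?; exact: cvg_cst.
- apply: cosk_ext => [i|i j ij]; last first.
    by case: (offdiag1 (exist (fun d : 'I_1 * 'I_1 => d.1 != d.2) (i, j) ij)).
  by rewrite /= restr1_unary.
- move=> n a s; apply: cosk_ext => [i|i j ij].
    by rewrite -(permKV s i) cosk1_act /= (restr1_act hA).
  move: ij; rewrite -(permKV s i) -(permKV s j); move: (_ i) (_ j) => i' j' ij.
  have ij' : i' != j' by apply: contra_neq ij => ->.
  by rewrite cosk2_mapA [RHS](cosk2_act _ ij') cosk2_mapA (restr2_act hA _ ij').
- move=> k n a c; apply: cosk_ext => [u|u v uv].
    have [i [p ->]] := RankP u; rewrite [RHS]cosk1_comp /= /mulAB /=.
    by rewrite (restr1_comp hA) lmul1.
  have [i [p ?]] := RankP u; have [j [q ?]] := RankP v; subst u v.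
  have [ij|ij] := eqVneq i j; last first.
    rewrite [RHS](cosk2_comp_diff _ _ _ ij) !cosk2_mapA /= ractAB_inA // /ractA /=.
    by rewrite (restr2_comp_diff hA _ _ ij) !lmul1.
  subst j; have pq : p != q by rewrite -(Rank_eq_same (n := n)).
  rewrite [RHS](cosk2_comp_same _ _ _ pq) !cosk2_mapA /= lactAB_inA // /lactA /=.
  by rewrite (restr2_comp_same hA _ _ pq) !lmul1.
Defined.

Definition cosk_mapB : operad_map B X.
Proof.
exists cosk_mapB_fun.
- move=> n; apply: cosk_continuous => [|i|i j ij]; first exact: op_kspace.
    apply: kprod_pair_continuous; first exact: op_kspace.
      by move=> ?; exact: cvg_cst.
    exact: restr1_continuous.
  under eq_fun do rewrite cosk2_mapB.
  apply: (continuous_compose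
      (f := fun b : B n => ((op_id, op_id), restr2 zB b ij) : binaryB A B))
    (@inB_continuous _ _ _ _).
  apply: kprod_pair_continuous; [exact: op_kspace| |exact: restr2_continuous].
  by move=> ?; exact: cvg_cst.
- apply: cosk_ext => [i|i j ij]; last first.
    by case: (offdiag1 (exist (fun d : 'I_1 * 'I_1 => d.1 != d.2) (i, j) ij)).
  by rewrite /= restr1_unary.
- move=> n a s; apply: cosk_ext => [i|i j ij].
    by rewrite -(permKV s i) cosk1_act /= (restr1_act hB).
  move: ij; rewrite -(permKV s i) -(permKV s j); move: (_ i) (_ j) => i' j' ij.
  have ij' : i' != j' by apply: contra_neq ij => ->.
  by rewrite cosk2_mapB [RHS](cosk2_act _ ij') cosk2_mapB (restr2_act hB _ ij').
- move=> k n a c; apply: cosk_ext => [u|u v uv].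
    have [i [p ->]] := RankP u; rewrite [RHS]cosk1_comp /= /mulAB /=.
    by rewrite (restr1_comp hB) lmul1.
  have [i [p ?]] := RankP u; have [j [q ?]] := RankP v; subst u v.
  have [ij|ij] := eqVneq i j; last first.
    rewrite [RHS](cosk2_comp_diff _ _ _ ij) !cosk2_mapB /= ractAB_inB // /ractB /=.
    by rewrite (restr2_comp_diff hB _ _ ij) !lmul1.
  subst j; have pq : p != q by rewrite -(Rank_eq_same (n := n)).
  rewrite [RHS](cosk2_comp_same _ _ _ pq) !cosk2_mapB /= lactAB_inB // /lactB /=.
  by rewrite (restr2_comp_same hB _ _ pq) !lmul1.
Defined.

Lemma transpose_permP k l (u : 'I_(\sum_(j < l) k)) :
  exists (i : 'I_k) (j : 'I_l), u = transpose_perm k l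
    (cast_ord (transpose_card k l) (Rank (p_ := fun _ : 'I_k => l) i j)).
Proof. by have [j [i ->]] := RankP u; exists i, j; rewrite transpose_permE. Qed.

(** The inputs form a k by l array. For two inputs in one row or one column, both sides reduce to
    the same point of one summand of the pushout. For inputs that differ in both directions, the
    sides lie in different summands. *)
Lemma cosk_interchanging : interchanging cosk_mapA cosk_mapB.
Proof.
move=> k l a b.
apply: (@cosk_ext bim _
  (cosk_act (cast_arity (cosk bim) (transpose_card k l)
    (cosk_comp (n := fun _ : 'I_k => l) (cosk_mapA_fun a) (fun=> cosk_mapB_fun b)))
    (transpose_perm k l))
  (cosk_comp (n := fun _ : 'I_l => k) (cosk_mapB_fun b) (fun=> cosk_mapA_fun a)))
  => [u|u v uv].
  have [i [j ->]] := transpose_permP u.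
  rewrite cosk1_act cosk1_cast cast_ord_comp cast_ord_id.
  rewrite transpose_permE !cosk1_comp /= /mulAB /=.
  by rewrite !lmul1 !lmulr1.
have [i [j ?]] := transpose_permP u; have [i' [j' ?]] := transpose_permP v; subst u v.
have hR : Rank (p_ := fun _ : 'I_k => l) i j != Rank (p_ := fun _ : 'I_k => l) i' j'.
  by apply: contra_neq uv => ->.
have hC : cast_ord (transpose_card k l) (Rank (p_ := fun _ : 'I_k => l) i j)
    != cast_ord (transpose_card k l) (Rank (p_ := fun _ : 'I_k => l) i' j').
  by apply: contra_neq uv => ->.
have hS : Rank (p_ := fun _ : 'I_l => k) j i != Rank (p_ := fun _ : 'I_l => k) j' i'.
  by move: uv; rewrite !transpose_permE.
transitivity (cosk2 (cast_arity (cosk bim) (transpose_card k l)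
  (cosk_comp (n := fun _ : 'I_k => l) (cosk_mapA_fun a) (fun=> cosk_mapB_fun b))) hC).
  exact: (@cosk2_act bim _ _ _ _ _ hC uv).
transitivity (cosk2 (cosk_comp (n := fun _ : 'I_k => l) (cosk_mapA_fun a)
    (fun=> cosk_mapB_fun b)) hR).
  by apply: cosk2_cast; rewrite cast_ord_comp cast_ord_id.
transitivity (cosk2 (cosk_comp (n := fun _ : 'I_l => k) (cosk_mapB_fun b)
    (fun=> cosk_mapA_fun a)) hS); last by apply: cosk2_eq; rewrite transpose_permE.
have [ii|ii] := eqVneq i i'; have [jj|jj] := eqVneq j j'.
- by exfalso; move: uv; rewrite ii jj eqxx.
- subst i'; rewrite (cosk2_comp_same (n := fun _ : 'I_k => l) _ _ _ jj).
  rewrite (cosk2_comp_diff _ _ _ jj) !cosk2_mapB /=.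
  rewrite lactAB_inB // ractAB_inB // /lactB /ractB /=.
  by rewrite !lmul1 !lmulr1 pair2_same rmul1.
- subst j'; rewrite (cosk2_comp_same (n := fun _ : 'I_l => k) _ _ _ ii).
  rewrite (cosk2_comp_diff _ _ _ ii) !cosk2_mapA /=.
  rewrite lactAB_inA // ractAB_inA // /lactA /ractA /=.
  by rewrite !lmul1 !lmulr1 pair2_same rmul1.
(* Here the gluing is needed, for the binary restrictions of [a] to [i, i'] and of [b] to
   [j, j']. *)
- rewrite (cosk2_comp_diff _ _ _ ii) (cosk2_comp_diff _ _ _ jj).
  rewrite cosk2_mapA cosk2_mapB /=.
  rewrite ractAB_inA // ractAB_inB // /ractA /ractB /= !pair2_same !rmul1 !lmul1.
  have := glueAB hA hB (restr2 zA a ii) (restr2 zB b jj).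
  rewrite (restr1_restr2l hA) (restr1_restr2r hA).
  by rewrite (restr1_restr2l hB) (restr1_restr2r hB).
Qed.

End CoskMaps.

(** * The tensor product in arities one and two *)


Section Tensor.
Context (A B T : operad) (zA : A 0) (zB : B 0).
Context (hA : forall x : A 0, x = zA) (hB : forall y : B 0, y = zB).
Context (jA : operad_map A T) (jB : operad_map B T).
Context (jAB : interchanging jA jB) (jext : tensor_extends jA jB).
Context (jepi : jointly_epic jA jB).

(** Interchange in free algebras, where the transposition is absorbed by indexing the arguments with
    [i] and [j]. *)
Lemma eval_interchange L k l (a : A k) (b : B l) (e : 'I_k -> 'I_l -> labelled T L) :
  lsim (eval (jA k a) (fun i => eval (jB l b) (fun j => e i j)))
       (eval (jB l b) (fun j => eval (jA k a) (fun i => e i j))).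
Proof.
pose E (u : 'I_(\sum_(j < l) k)) := e (sig2 u) (sig1 u).
have EE i j : E (Rank (p_ := fun _ : 'I_l => k) j i) = e i j.
  exact: (sig_Rank (n := fun _ : 'I_l => k) (fun j i => e i j)).
have <- : eval (op_comp (fun _ : 'I_l => k) (jB l b) (fun=> jA k a)) E
    = eval (jB l b) (fun j => eval (jA k a) (fun i => e i j)).
  rewrite eval_comp; congr eval; apply/funext => j; congr eval.
  by apply/funext => i; exact: EE.
rewrite -jAB; apply: lsim_sym; apply: lsim_trans (eval_act _ _ _) _.
rewrite eval_cast eval_comp; apply: eval_cong => i; apply: eval_cong => j.
by rewrite transpose_permE EE; exact: lsim_refl.
Qed.

Local Notation zT := (jA 0 zA).

Lemma eval_arity0 (x : T 0) (e : 'I_0 -> labelled T 'I_0) : eval x e = gen x.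
Proof.
rewrite /gen -(eval_lit x id); congr eval; apply/funext; by case.
Qed.

(** This is interchange for [k = l = 0]: each side is a nullary operation applied to no
    arguments. *)
Lemma jB_zero : jB 0 zB = zT.
Proof.
have := eval_interchange zA zB (fun _ _ => gen zT).
by rewrite !eval_arity0 => /lsim_gen_inj.
Qed.

(* The operations annihilated by 0 form a suboperad containing A and B. *)
Lemma tensor0 (x : T 0) : x = zT.
Proof.
have mapz (O : operad) (F : operad_map O T) (z : O 0) : (forall y, y = z) ->
    F 0 z = zT -> forall n (y : O n), lsim (eval (F n y) (fun=> gen zT)) (gen zT).
  move=> z_uniq Fz n y; rewrite -Fz.
  have e0 : eval y (fun=> gen z) = gen z.
    have -> : gen z = zero z 'I_0 by exact: Lab0.
    exact: (eval0 z_uniq).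
  rewrite (_ : eval _ _ = gen (F 0 z)); first exact: lsim_refl.
  by rewrite -[LHS](map_eval F y (fun=> gen z)) e0.
suff : lsim (eval x (fun=> gen zT)) (gen zT) by rewrite eval_arity0 => /lsim_gen_inj.
pose S n (y : T n) := lsim (eval y (fun=> gen zT)) (gen zT).
apply: (@generation T S _ _ _ A B jA jB) => //.
- by rewrite /S eval_id; exact: lsim_refl.
- by move=> n y s Sy; exact: lsim_trans (eval_act _ _ _) Sy.
- move=> k n y c Sy Sc; rewrite /S eval_comp.
  exact: lsim_trans (eval_cong _ Sc) Sy.
- exact: mapz hA erefl.
- exact: mapz hB jB_zero.
Qed.

(** The case [k = 1] of interchange, in which the transposition is trivial. *)
Lemma lmul_interchange n (a : A 1) (b : B n) :
  lmul (jA 1 a) (jB n b) = rmul (jB n b) (fun=> jA 1 a).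
Proof.
apply: eval_inj => f; apply: lsim_trans (eval_lmul _ _ _) _.
apply: lsim_trans (eval_interchange _ _ (fun _ => f)) _.
by apply: lsim_sym; exact: eval_rmul.
Qed.

Lemma rmul_interchange n (a : A n) (b : B 1) :
  lmul (jB 1 b) (jA n a) = rmul (jA n a) (fun=> jB 1 b).
Proof.
apply: eval_inj => f; apply: lsim_trans (eval_lmul _ _ _) _.
apply: lsim_sym; apply: lsim_trans (eval_rmul _ _ _) _.
exact: (eval_interchange a b (fun i _ => f i)).
Qed.

Lemma lmulC (a : A 1) (b : B 1) : lmul (jB 1 b) (jA 1 a) = lmul (jA 1 a) (jB 1 b).
Proof. by rewrite rmul_interchange rmul_unary. Qed.

Definition phi1 (m : unaryAB A B) : T 1 := lmul (jA 1 m.1) (jB 1 m.2).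

Definition phi2A (y : binaryA A B) : T 2 :=
  rmul (jA 2 y.1) (pair2 (jB 1 y.2.1) (jB 1 y.2.2)).
Definition phi2B (z : binaryB A B) : T 2 :=
  rmul (jB 2 z.2) (pair2 (jA 1 z.1.1) (jA 1 z.1.2)).

Definition phi2 : binaryAB zA zB -> T 2 := pushout_rec phi2A phi2B.

Lemma map_restr1 (O : operad) (F : operad_map O T) (z : O 0) n (x : O n) i :
  F 1 (restr1 z x i) = restr1 zT (F n x) i.
Proof. by apply: map_restr; exact: tensor0. Qed.

Lemma map_restr2 (O : operad) (F : operad_map O T) (z : O 0) n (x : O n) i j
    (ij : i != j) :
  F 2 (restr2 z x ij) = restr2 zT (F n x) ij.
Proof. by apply: map_restr; exact: tensor0. Qed.

Lemma phi_glue (x : kprod (A 2) (B 2)) :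
  phi2A (restrict_snd zB x) = phi2B (restrict_fst zA x).
Proof.
case: x => a b; rewrite /phi2A /phi2B /= !(restrictE hA) !(restrictE hB).
rewrite !map_restr1 !pair2_eta.
apply: eval_inj => f; apply: lsim_trans (eval_rmul _ _ _) _.
(* Input [i] of [a] receives [b] restricted to its own input [i], so in the 2 by 2 array of inputs
   only the diagonal survives. This description is symmetric in [a] and [b]. *)
apply: (@lsim_trans _ _ (eval (jA 2 a) (fun i => eval (jB 2 b) (fun j =>
    if j == i then f i else zero zT 'I_2)))).
  by apply: eval_cong => i; exact: (eval_restr1 tensor0).
apply: lsim_trans (eval_interchange _ _ _) _.
apply: lsim_sym; apply: lsim_trans (eval_rmul _ _ _) _; apply: eval_cong => j.
apply: lsim_trans (eval_restr1 tensor0 _ _ _) _; apply: eval_cong => i.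
by rewrite eq_sym; case: eqVneq => [->|_]; exact: lsim_refl.
Qed.

Lemma phi2_inA y : phi2 (inA zA zB y) = phi2A y.
Proof. exact: (pushout_rec1 phi_glue). Qed.

Lemma phi2_inB z : phi2 (inB zA zB z) = phi2B z.
Proof. exact: (pushout_rec2 phi_glue). Qed.

Lemma phi1_continuous : continuous phi1.
Proof.
have k := @kspace_kify (A 1 * B 1)%type.
apply: lmul_continuous => //.
  exact: continuous_compose (@kprod_fst_continuous _ _) (@op_map_continuous _ _ jA 1).
exact: continuous_compose (@kprod_snd_continuous _ _) (@op_map_continuous _ _ jB 1).
Qed.

Lemma phi2_continuous : continuous phi2.
Proof.
have cA n := @op_map_continuous _ _ jA n; have cB n := @op_map_continuous _ _ jB n.
apply: pushout_continuous.
- under eq_fun do rewrite -/(inA zA zB _) phi2_inA.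
  have k : kspace (binaryA A B) by exact: kspace_kify.
  have c1 := @kprod_fst_continuous (A 2) (kprod (B 1) (B 1)).
  have c2 := @kprod_snd_continuous (A 2) (kprod (B 1) (B 1)).
  have c21 := kprod_fst_comp c2; have c22 := kprod_snd_comp c2.
  apply: rmul_continuous => //; first exact: continuous_compose c1 (cA 2).
  apply: pair2_continuous.
    exact: continuous_compose c21 (cB 1).
  exact: continuous_compose c22 (cB 1).
- under eq_fun do rewrite -/(inB zA zB _) phi2_inB.
  have k : kspace (binaryB A B) by exact: kspace_kify.
  have c1 := @kprod_fst_continuous (kprod (A 1) (A 1)) (B 2).
  have c2 := @kprod_snd_continuous (kprod (A 1) (A 1)) (B 2).
  have c11 := kprod_fst_comp c1; have c12 := kprod_snd_comp c1.
  apply: rmul_continuous => //; first exact: continuous_compose c2 (cB 2).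
  apply: pair2_continuous.
    exact: continuous_compose c11 (cA 1).
  exact: continuous_compose c12 (cA 1).
Qed.

(** Unary operations from [A] and [B] commute in [T], so [phi1] is a monoid map. With [phi2_lmul]
    and [phi2_rmul], this makes the images of [phi1] and [phi2] stable under the products that occur
    in restrictions of composites. *)
Lemma phi1_lmul m m' : lmul (phi1 m) (phi1 m') = phi1 (mulAB m m').
Proof.
rewrite /phi1 /mulAB /= !map_lmul -!lmulA; congr lmul.
by rewrite !lmulA lmulC.
Qed.

Lemma pair2_lmull (O : operad) (x a b : O 1) :
  (fun i => lmul x (pair2 a b i)) = pair2 (lmul x a) (lmul x b).
Proof. by apply/funext => i; rewrite /pair2; case: ifP. Qed.

Lemma phi2_lmul m p : lmul (phi1 m) (phi2 p) = phi2 (lactAB m p).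
Proof.
elim/binaryAB_ind: p => [y|z].
- rewrite lactAB_inA // !phi2_inA /phi1 /phi2A /lactA /= !map_lmul -lmulA rmul_lmul.
  by rewrite rmul_interchange rmulA pair2_lmull rmul_lmul.
- rewrite lactAB_inB // !phi2_inB /phi1 /phi2B /lactB /= !map_lmul -lmulA !rmul_lmul.
  by rewrite -map_lmul lmul_interchange rmulA pair2_lmull.
Qed.

Lemma phi2_rmul p m m' :
  rmul (phi2 p) (pair2 (phi1 m) (phi1 m')) = phi2 (ractAB p m m').
Proof.
elim/binaryAB_ind: p => [y|z].
- rewrite ractAB_inA // !phi2_inA /phi1 /phi2A /ractA /= map_rmul !map_lmul.
  have -> : (fun i => jA 1 (pair2 m.1 m'.1 i)) = pair2 (jA 1 m.1) (jA 1 m'.1).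
    by apply/funext => i; exact: pair2_comp.
  by rewrite !rmulA !pair2_lmul !lmulA !lmulC.
- rewrite ractAB_inB // !phi2_inB /phi1 /phi2B /ractB /= map_rmul !map_lmul.
  have -> : (fun i => jB 1 (pair2 m.2 m'.2 i)) = pair2 (jB 1 m.2) (jB 1 m'.2).
    by apply/funext => i; exact: pair2_comp.
  (* In this summand each [B] factor has to pass two [A] factors, hence the two rounds of
     [lmulC]. *)
  by rewrite !rmulA !pair2_lmul !lmulA !lmulC -!lmulA !lmulC !lmulA.
Qed.

(** Stated in all arities, since an operation of arity one or two may be composed from operations of
    any arity. The property is closed under composition by the rules for restricting composites. *)
Lemma phi_surj n (x : T n) :
  (forall i, exists m, restr1 zT x i = phi1 m) /\
  (forall i j (ij : i != j), exists p, restr2 zT x ij = phi2 p).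
Proof.
pose S n (y : T n) := (forall i, exists m, restr1 zT y i = phi1 m) /\
  (forall i j (ij : i != j), exists p, restr2 zT y ij = phi2 p).
apply: (@generation T S _ _ _ A B jA jB) => //.
- split=> [i|i j ij].
    exists (op_id, op_id); rewrite (restr1_unary tensor0) /phi1 /= !op_map_id lmul1 //.
  by case: (offdiag1 (exist (fun d : 'I_1 * 'I_1 => d.1 != d.2) (i, j) ij)).
- move=> m y s [S1 S2]; split=> [i|i j].
    by rewrite -(permKV s i) (restr1_act tensor0); exact: S1.
  rewrite -(permKV s i) -(permKV s j); move: (_ i) (_ j) => i' j' ij.
  have ij' : i' != j' by apply: contra_neq ij => ->.
  by rewrite (restr2_act tensor0 _ ij'); exact: S2.
- move=> k m y c [S1 S2] Sc; split=> [u|u v].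
    have [i [p ->]] := RankP u; rewrite (restr1_comp tensor0).
    have [m1 ->] := S1 i; have [m2 ->] := (Sc i).1 p.
    by exists (mulAB m1 m2); rewrite phi1_lmul.
  have [i [p ->]] := RankP u; have [j [q ->]] := RankP v => h.
  have [ij|ij] := eqVneq i j; last first.
    rewrite (restr2_comp_diff tensor0 _ _ ij).
    have [p1 ->] := S2 _ _ ij; have [m1 ->] := (Sc i).1 p.
    have [m2 ->] := (Sc j).1 q.
    by exists (ractAB p1 m1 m2); rewrite phi2_rmul.
  subst j; have pq : p != q by rewrite -(Rank_eq_same (n := m)).
  rewrite (restr2_comp_same tensor0 _ _ pq).
  have [m1 ->] := S1 i; have [p1 ->] := (Sc i).2 _ _ pq.
  by exists (lactAB m1 p1); rewrite phi2_lmul.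
- move=> m a; split=> [i|i j ij].
    exists (restr1 zA a i, op_id).
    by rewrite -(map_restr1 _ zA) /phi1 /= op_map_id lmulr1.
  exists (inA zA zB (restr2 zA a ij, (op_id, op_id))).
  by rewrite -(map_restr2 _ zA) phi2_inA /phi2A /= op_map_id pair2_same rmul1.
- move=> m b; split=> [i|i j ij].
    exists (op_id, restr1 zB b i).
    by rewrite -(map_restr1 _ zB) /phi1 /= op_map_id lmul1.
  exists (inB zA zB ((op_id, op_id), restr2 zB b ij)).
  by rewrite -(map_restr2 _ zB) phi2_inB /phi2B /= op_map_id pair2_same rmul1.
Qed.

Lemma phi1_surj (x : T 1) : exists m, x = phi1 m.
Proof.
by have [m] := (phi_surj x).1 ord0; rewrite (restr1_unary tensor0) => ->; exists m.
Qed.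

Lemma ord2_neq : ord0 != ord_max :> 'I_2.
Proof. by []. Qed.

Lemma phi2_surj (x : T 2) : exists p, x = phi2 p.
Proof.
have [p] := (phi_surj x).2 _ _ ord2_neq; rewrite (restr2_binary tensor0) => ->.
by exists p.
Qed.

(** * The inverse maps *)

Section Inverse.
Local Notation bim := (bimoduleAB hA hB).
Local Notation X := (cosk_operad bim).
Context (h : operad_map T X).
Context (hjA : forall n x, h n (jA n x) = cosk_mapA hA hB n x).
Context (hjB : forall n x, h n (jB n x) = cosk_mapB hA hB n x).

Definition psi1 (x : T 1) : unaryAB A B := (h 1 x : cosk bim 1).1 ord0.
Definition psi2 (x : T 2) : binaryAB zA zB := cosk2 (h 2 x : cosk bim 2) ord2_neq.

Lemma psi1_jA a : psi1 (jA 1 a) = (a, op_id).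
Proof. by rewrite /psi1 hjA /= (restr1_unary hA). Qed.

Lemma psi1_jB b : psi1 (jB 1 b) = (op_id, b).
Proof. by rewrite /psi1 hjB /= (restr1_unary hB). Qed.

Lemma psi2_jA a : psi2 (jA 2 a) = inA zA zB (a, (op_id, op_id)).
Proof. by rewrite /psi2 hjA [LHS]cosk2_mapA (restr2_binary hA). Qed.

Lemma psi2_jB b : psi2 (jB 2 b) = inB zA zB ((op_id, op_id), b).
Proof. by rewrite /psi2 hjB [LHS]cosk2_mapB (restr2_binary hB). Qed.

Lemma psi1_lmul x y : psi1 (lmul x y) = mulAB (psi1 x) (psi1 y).
Proof. by rewrite /psi1 map_lmul cosk1_lmul. Qed.

Lemma psi2_rmul x y0 y1 :
  psi2 (rmul x (pair2 y0 y1)) = ractAB (psi2 x) (psi1 y0) (psi1 y1).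
Proof.
rewrite /psi2 map_rmul.
have -> : (fun i => h 1 (pair2 y0 y1 i)) = pair2 (h 1 y0) (h 1 y1).
  by apply/funext => i; exact: pair2_comp.
exact: (@cosk2_rmul bim (h 2 x) (h 1 y0) (h 1 y1) ord2_neq).
Qed.

Lemma phi1K : cancel phi1 psi1.
Proof.
by case=> a b; rewrite /phi1 psi1_lmul psi1_jA psi1_jB /mulAB /= lmul1 lmulr1.
Qed.

(** [psi2] turns [a o (b + b')] into the point of [a] with units, acted on from the right by [b] and
    [b']; cancelling units gives back the original point. The other summand is symmetric. *)
Lemma phi2K : cancel phi2 psi2.
Proof.
move=> p; elim/binaryAB_ind: p => [[a [b b']]|[[a a'] b]].
  rewrite phi2_inA /phi2A psi2_rmul psi2_jA !psi1_jB ractAB_inA // /ractA /=.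
  by rewrite !lmul1 pair2_same rmul1.
rewrite phi2_inB /phi2B psi2_rmul psi2_jB !psi1_jA ractAB_inB // /ractB /=.
by rewrite !lmul1 pair2_same rmul1.
Qed.

(** A left inverse of a surjection is a two-sided inverse. *)
Lemma psi1K : cancel psi1 phi1.
Proof. by move=> x; have [m ->] := phi1_surj x; rewrite phi1K. Qed.

Lemma psi2K : cancel psi2 phi2.
Proof. by move=> x; have [m ->] := phi2_surj x; rewrite phi2K. Qed.

Lemma psi1_continuous : continuous psi1.
Proof.
exact: continuous_compose (@op_map_continuous _ _ h 1) (@cosk1_continuous bim 1 ord0).
Qed.

Lemma psi2_continuous : continuous psi2.
Proof.
exact: continuous_compose (@op_map_continuous _ _ h 2)
  (@cosk2_continuous bim 2 _ _ ord2_neq).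
Qed.

End Inverse.

End Tensor.

Theorem proposition4p8 (A B T : operad) (zA : A 0) (zB : B 0)
    (hA : forall x : A 0, x = zA) (hB : forall y : B 0, y = zB)
    (hT : is_tensor A B T) :
  homeomorphic (T 1) (kprod (A 1) (B 1)) /\
  homeomorphic (T 2)
    (pushout (restrict_snd (A := A) zB) (restrict_fst (B := B) zA)).
Proof.
have [jA [jB [jAB jext jepi]]] := tensorP hT.
(* The coordinates of [h] in arities one and two are the inverses [psi1] and [psi2]. *)
have [h [hjA hjB]] := jext _ _ _ (cosk_interchanging hA hB).
split.
  exists (psi1 h), (phi1 jA jB); split.
  - exact: psi1_continuous.
  - exact: phi1_continuous.
  - exact: (psi1K jAB jext jepi hjA hjB).
  - exact: (phi1K hjA hjB).
exists (psi2 h), (phi2 jA jB); split.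
- exact: psi2_continuous.
- exact: (phi2_continuous hA hB jAB jext jepi).
- exact: (psi2K jAB jext jepi hjA hjB).
- exact: (phi2K jAB jext jepi hjA hjB).
Qed.
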